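(* Let $K$ be a field, $S=K[x_1,\dots,x_m,y_1,\dots,y_n]$ the standard bigraded polynomial ring, $K[x]=K[x_1,\dots,x_m]$, $Q=(y_1,\dots,y_n)$. Let $M$ be a finitely generated bigraded $S$-module with $\operatorname{cd}(Q,M)=0$, and let $$\mathbb{F}:\ 0\to F_{m+n}\xrightarrow{\varphi_{m+n}}F_{m+n-1}\to\cdots\to F_1\xrightarrow{\varphi_1}F_0\to0$$ be a bigraded free resolution of $M$ by finitely generated bigraded free $S$-modules. Then for all $j\in\mathbb{Z}$, the finitely generated graded $K[x]$-module $M_j=\bigoplus_{k\in\mathbb{Z}}M_{(k,j)}$ has a free $K[x]$-resolution of the form $$0\to H^n_Q(F_{m+n})_j\to\cdots\to H^n_Q(F_{n+1})_j\to\operatorname{Ker}\psi_n\to M_j\to0,$$ where $\psi_i:H^n_Q(F_i)_j\to H^n_Q(F_{i-1})_j$ is induced by $\varphi_i$.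
   Context: $S$ is bigraded by $\deg x_i=(1,0)$ and $\deg y_j=(0,1)$. $\operatorname{cd}(Q,M)$ is the largest $i$ with $H^i_Q(M)\neq0$. For a bigraded $S$-module $N$, $H^i_Q(N)_j=\bigoplus_{k\in\mathbb{Z}}H^i_Q(N)_{(k,j)}$, a graded $K[x]$-module; if $N=F$ is a finitely generated bigraded free $S$-module then $H^n_Q(F)_j$ is a finitely generated graded free $K[x]$-module. If $n=0$, $\psi_0$ is the map to $0$. *)

(* Defs.v *)
From HB Require Import structures.
From mathcomp Require Import all_boot all_order all_algebra.
From mathcomp Require Import generic_quotient ring_quotient boolp.
From mathcomp Require Import mpoly zify ring.

Set Implicit Arguments.
Unset Strict Implicit.
Unset Printing Implicit Defensive.

Import GRing.Theory.
Local Open Scope ring_scope.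
Local Open Scope quotient_scope.

Record submod (A : nzRingType) (V : lmodType A) := Submod {
  spred :> V -> Prop;
  spred0 : spred 0;
  spredL : forall a u v, spred u -> spred v -> spred (a *: u + v) }.

Section Submodule.
Variables (A : nzRingType) (V : lmodType A) (P : submod V).

Definition smem : {pred V} := fun v => `[< P v >].

Lemma smemP v : reflect (P v) (v \in smem).
Proof. exact: asboolP. Qed.

Lemma smem_closed : submod_closed smem.
Proof.
split; first by apply/smemP/spred0.
by move=> a u v /smemP Pu /smemP Pv; apply/smemP/spredL.
Qed.
HB.instance Definition _ := GRing.isSubmodClosed.Build A V smem smem_closed.

(* The submodule P as a module in its own right. *)
Record smod := SMod { smod_val :> V; smod_valP : smod_val \in smem }.
HB.instance Definition _ := [isSub for smod_val].
HB.instance Definition _ := [Choice of smod by <:].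
HB.instance Definition _ := [SubChoice_isSubLmodule of smod by <:].

(* The quotient module V / P, with projection qpi. *)
Definition qmod : Type := Quotient.quot smem.
HB.instance Definition _ := GRing.Zmodule.on qmod.
Definition qpi (v : V) : qmod := \pi_(Quotient.quot smem) v.
Definition qscale (a : A) (u : qmod) : qmod := qpi (a *: (repr u : V)).

Lemma qpiE u v : (qpi u = qpi v) <-> P (u - v).
Proof.
split=> [/eqP|h].
  by rewrite -Quotient.idealrBE => /smemP.
by apply/eqP; rewrite -Quotient.idealrBE; apply/smemP.
Qed.
Lemma qpi_surj u : exists v, qpi v = u.
Proof. by exists (repr u); rewrite /qpi reprK. Qed.
Lemma qpiD u v : qpi (u + v) = qpi u + qpi v.
Proof. exact: raddfD. Qed.
Lemma qpi0 : qpi 0 = 0.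
Proof. exact: raddf0. Qed.
Lemma qpiN u : qpi (- u) = - qpi u.
Proof. exact: raddfN. Qed.
Lemma spredZ a u : P u -> P (a *: u).
Proof. by move=> Pu; rewrite -[_ *: _]addr0; apply: spredL => //; apply: spred0. Qed.
Lemma qpiZ a u : qscale a (qpi u) = qpi (a *: u).
Proof.
apply/qpiE; rewrite -scalerBr; apply: spredZ; apply/qpiE.
by rewrite /qpi reprK.
Qed.
Lemma qscaleA a b u : qscale a (qscale b u) = qscale (a * b) u.
Proof. by have [v <-] := qpi_surj u; rewrite !qpiZ scalerA. Qed.
Lemma qscale1 : left_id 1 qscale.
Proof. by move=> u; have [v <-] := qpi_surj u; rewrite qpiZ scale1r. Qed.
Lemma qscaleDr : right_distributive qscale +%R.
Proof.
move=> a u u'; have [v <-] := qpi_surj u; have [v' <-] := qpi_surj u'.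
by rewrite -qpiD !qpiZ scalerDr qpiD.
Qed.
Lemma qscaleDl u : {morph qscale^~ u : a b / a + b}.
Proof.
by move=> a b; have [v <-] := qpi_surj u; rewrite !qpiZ scalerDl qpiD.
Qed.
HB.instance Definition _ := GRing.Zmodule_isLmodule.Build A qmod
  qscaleA qscale1 qscaleDr qscaleDl.

Lemma qpi_is_linear : linear qpi.
Proof. by move=> a u v; rewrite qpiD -qpiZ. Qed.
HB.instance Definition _ := GRing.isLinear.Build A V qmod *:%R qpi qpi_is_linear.
End Submodule.

Definition restr (A B : nzRingType) (f : {rmorphism A -> B}) (V : lmodType B) : Type := V.

Section RestrictionOfScalars.
Variables (A B : nzRingType) (f : {rmorphism A -> B}) (V : lmodType B).
HB.instance Definition _ := GRing.Zmodule.on (restr f V).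
Definition restr_scale (a : A) (v : restr f V) : restr f V := f a *: (v : V).
Lemma restr_scaleA a b u : restr_scale a (restr_scale b u) = restr_scale (a * b) u.
Proof. by rewrite /restr_scale scalerA rmorphM. Qed.
Lemma restr_scale1 : left_id 1 restr_scale.
Proof. by move=> u; rewrite /restr_scale rmorph1 scale1r. Qed.
Lemma restr_scaleDr : right_distributive restr_scale +%R.
Proof. by move=> a u v; rewrite /restr_scale scalerDr. Qed.
Lemma restr_scaleDl u : {morph restr_scale^~ u : a b / a + b}.
Proof. by move=> a b; rewrite /restr_scale rmorphD scalerDl. Qed.
HB.instance Definition _ := GRing.Zmodule_isLmodule.Build A (restr f V)
  restr_scaleA restr_scale1 restr_scaleDr restr_scaleDl.
End RestrictionOfScalars.


Section Product.
Variables (A : nzRingType) (I : finType) (V : I -> lmodType A).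
Definition prodmod : Type := {dffun forall i, V i}.
HB.instance Definition _ := Choice.on prodmod.
Definition prod_mk (c : forall i, V i) : prodmod := [ffun i => c i].
Definition prod_pr i (c : prodmod) : V i := (c : {dffun forall i, V i}) i.
Lemma prod_mkE c i : prod_pr i (prod_mk c) = c i.
Proof. by rewrite /prod_pr ffunE. Qed.
Lemma prod_eq c c' : (forall i, prod_pr i c = prod_pr i c') -> c = c'.
Proof. by move=> h; apply/ffunP. Qed.
Definition prod_zero := prod_mk (fun i => 0).
Definition prod_opp c := prod_mk (fun i => - prod_pr i c).
Definition prod_add c c' := prod_mk (fun i => prod_pr i c + prod_pr i c').
Definition prod_scale a c := prod_mk (fun i => a *: prod_pr i c).
Lemma prod_addA : associative prod_add.
Proof. by move=> a b c; apply: prod_eq => i; rewrite !prod_mkE addrA. Qed.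
Lemma prod_addC : commutative prod_add.
Proof. by move=> a b; apply: prod_eq => i; rewrite !prod_mkE addrC. Qed.
Lemma prod_add0 : left_id prod_zero prod_add.
Proof. by move=> a; apply: prod_eq => i; rewrite !prod_mkE add0r. Qed.
Lemma prod_addN : left_inverse prod_zero prod_opp prod_add.
Proof. by move=> a; apply: prod_eq => i; rewrite !prod_mkE addNr. Qed.
HB.instance Definition _ := GRing.isZmodule.Build prodmod
  prod_addA prod_addC prod_add0 prod_addN.
Lemma prod_scaleA a b u : prod_scale a (prod_scale b u) = prod_scale (a * b) u.
Proof. by apply: prod_eq => i; rewrite !prod_mkE scalerA. Qed.
Lemma prod_scale1 : left_id 1 prod_scale.
Proof. by move=> u; apply: prod_eq => i; rewrite !prod_mkE scale1r. Qed.
Lemma prod_scaleDr : right_distributive prod_scale +%R.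
Proof. by move=> a u v; apply: prod_eq => i; rewrite !prod_mkE scalerDr. Qed.
Lemma prod_scaleDl u : {morph prod_scale^~ u : a b / a + b}.
Proof. by move=> a b; apply: prod_eq => i; rewrite !prod_mkE scalerDl. Qed.
HB.instance Definition _ := GRing.Zmodule_isLmodule.Build A prodmod
  prod_scaleA prod_scale1 prod_scaleDr prod_scaleDl.
Lemma prod_pr_is_linear i : linear (prod_pr i).
Proof. by move=> a u v; rewrite !prod_mkE. Qed.
HB.instance Definition _ i := GRing.isLinear.Build A prodmod (V i) *:%R (prod_pr i)
  (prod_pr_is_linear i).
Lemma prod_pr_sum (J : Type) (r : seq J) (F : J -> prodmod) i :
  prod_pr i (\sum_(j <- r) F j) = \sum_(j <- r) prod_pr i (F j).
Proof. exact: (raddf_sum (prod_pr i)). Qed.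
End Product.

Section Localization.
Variables (A : comNzRingType) (f : A) (V : lmodType A).

(* The localization V_f at the powers of f: the pair (v, k) stands for the
   fraction v / f^k. *)
Definition loc_rel (x y : V * nat) : bool :=
  `[< exists e, f ^+ (e + y.2) *: x.1 = f ^+ (e + x.2) *: y.1 >].

Lemma loc_rel_equiv : equiv_class_of loc_rel.
Proof.
split=> [x|x y|y x z].
- by apply/asboolP; exists 0%N.
- by apply/asboolP/asboolP => -[e he]; exists e.
- move=> /asboolP[e he] /asboolP[e' he']; apply/asboolP.
  exists (e + e' + y.2)%N.
  rewrite (_ : (_ + z.2)%N = (e' + z.2 + (e + y.2))%N); last by lia.
  rewrite exprD -scalerA he scalerA -exprD.
  rewrite (_ : (_ + (e + x.2))%N = (e + x.2 + (e' + z.2))%N); last by lia.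
  rewrite exprD -scalerA he' scalerA -exprD; congr (f ^+ _ *: _); lia.
Qed.
Canonical loc_equiv := EquivRelPack loc_rel_equiv.
Canonical loc_encModRel := defaultEncModRel loc_rel.

Definition loc : Type := {eq_quot loc_rel}.
HB.instance Definition _ := Choice.on loc.
Definition lfrac (v : V) (k : nat) : loc := \pi_({eq_quot loc_rel}) (v, k).
Definition lrep (u : loc) : V * nat := repr (u : {eq_quot loc_rel}).

Lemma lfracP v k w l :
  (lfrac v k = lfrac w l) <-> exists e, f ^+ (e + l) *: v = f ^+ (e + k) *: w.
Proof.
split=> [h|h]; last by apply/eqmodP/asboolP.
by have /eqmodP/asboolP := h.
Qed.
Lemma lrepK u : lfrac (lrep u).1 (lrep u).2 = u.
Proof. by rewrite /lfrac -surjective_pairing /lrep reprK. Qed.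
Lemma locW (P : loc -> Prop) : (forall v k, P (lfrac v k)) -> forall u, P u.
Proof. by move=> h u; rewrite -(lrepK u). Qed.
Lemma lfrac_expand e v k : lfrac (f ^+ e *: v) (e + k) = lfrac v k.
Proof. by apply/lfracP; exists 0%N; rewrite !add0n scalerA -exprD addnC. Qed.

Definition loc_add u u' := lfrac
  (f ^+ (lrep u').2 *: (lrep u).1 + f ^+ (lrep u).2 *: (lrep u').1)
  ((lrep u).2 + (lrep u').2).
Definition loc_opp u := lfrac (- (lrep u).1) (lrep u).2.
Definition loc_scale a u := lfrac (a *: (lrep u).1) (lrep u).2.
Definition loc_zero := lfrac 0 0.

Lemma loc_addE v k w l :
  loc_add (lfrac v k) (lfrac w l) = lfrac (f ^+ l *: v + f ^+ k *: w) (k + l).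
Proof.
rewrite /loc_add.
case E: (lrep (lfrac v k)) => [v' k']; case E': (lrep (lfrac w l)) => [w' l'] /=.
have /lfracP[e he] : lfrac v' k' = lfrac v k by rewrite -[RHS]lrepK E.
have /lfracP[e' he'] : lfrac w' l' = lfrac w l by rewrite -[RHS]lrepK E'.
apply/lfracP; exists (e + e')%N; rewrite !scalerDr !scalerA -!exprD; congr (_ + _).
- rewrite (_ : (_ + l')%N = (e' + l + l' + (e + k))%N); last by lia.
  rewrite exprD -scalerA he scalerA -exprD; congr (f ^+ _ *: _); lia.
- rewrite (_ : (_ + k')%N = (e + k + k' + (e' + l))%N); last by lia.
  rewrite exprD -scalerA he' scalerA -exprD; congr (f ^+ _ *: _); lia.
Qed.

Lemma loc_oppE v k : loc_opp (lfrac v k) = lfrac (- v) k.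
Proof.
rewrite /loc_opp; case E: (lrep (lfrac v k)) => [v' k'] /=.
have /lfracP[e he] : lfrac v' k' = lfrac v k by rewrite -[RHS]lrepK E.
by apply/lfracP; exists e; rewrite !scalerN he.
Qed.
Lemma loc_scaleE a v k : loc_scale a (lfrac v k) = lfrac (a *: v) k.
Proof.
rewrite /loc_scale; case E: (lrep (lfrac v k)) => [v' k'] /=.
have /lfracP[e he] : lfrac v' k' = lfrac v k by rewrite -[RHS]lrepK E.
by apply/lfracP; exists e; rewrite !scalerA ![_ * a]mulrC -!scalerA he.
Qed.
Lemma lfrac_eq v k w l : k = l -> v = w -> lfrac v k = lfrac w l.
Proof. by move=> -> ->. Qed.
Lemma loc_addA : associative loc_add.
Proof.
elim/locW=> a i; elim/locW=> b j; elim/locW=> c k; rewrite !loc_addE.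
apply: lfrac_eq; first by lia.
rewrite !scalerDr !scalerA -!exprD addrA; congr (_ *: _ + _ *: _ + _ *: _); congr (f ^+ _); lia.
Qed.
Lemma loc_addC : commutative loc_add.
Proof.
elim/locW=> a i; elim/locW=> b j; rewrite !loc_addE; apply: lfrac_eq; first by lia.
by rewrite addrC.
Qed.
Lemma loc_add0 : left_id loc_zero loc_add.
Proof.
by elim/locW=> a i; rewrite loc_addE scaler0 add0r expr0 scale1r.
Qed.
Lemma lfrac0 k : lfrac 0 k = loc_zero.
Proof. by apply/lfracP; exists 0%N; rewrite !scaler0. Qed.
Lemma loc_addN : left_inverse loc_zero loc_opp loc_add.
Proof.
elim/locW=> a i; rewrite loc_oppE loc_addE scalerN addNr; exact: lfrac0.
Qed.
HB.instance Definition _ := GRing.isZmodule.Build loc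
  loc_addA loc_addC loc_add0 loc_addN.
Lemma lfracD1 v w k : lfrac (v + w) k = lfrac v k + lfrac w k.
Proof.
by rewrite [RHS]loc_addE -scalerDr lfrac_expand.
Qed.
Lemma loc_scaleA a b u : loc_scale a (loc_scale b u) = loc_scale (a * b) u.
Proof. by elim/locW: u => v k; rewrite !loc_scaleE scalerA. Qed.
Lemma loc_scale1 : left_id 1 loc_scale.
Proof. by elim/locW=> v k; rewrite loc_scaleE scale1r. Qed.
Lemma loc_scaleDr : right_distributive loc_scale +%R.
Proof.
move=> a; elim/locW=> v k; elim/locW=> w l.
rewrite (loc_addE v k w l : lfrac v k + lfrac w l = _) !loc_scaleE [RHS]loc_addE.
by rewrite scalerDr !scalerA ![a * _]mulrC.
Qed.
Lemma loc_scaleDl u : {morph loc_scale^~ u : a b / a + b}.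
Proof. by elim/locW: u => v k a b; rewrite !loc_scaleE scalerDl lfracD1. Qed.
HB.instance Definition _ := GRing.Zmodule_isLmodule.Build A loc
  loc_scaleA loc_scale1 loc_scaleDr loc_scaleDl.

Lemma lfracD v k w l : lfrac v k + lfrac w l = lfrac (f ^+ l *: v + f ^+ k *: w) (k + l).
Proof. exact: loc_addE. Qed.
Lemma lfracZ a v k : a *: lfrac v k = lfrac (a *: v) k.
Proof. exact: loc_scaleE. Qed.
Lemma lfrac_is_linear k : linear (lfrac^~ k).
Proof. by move=> a u v; rewrite lfracD1 lfracZ. Qed.
Lemma lfracN v k : - lfrac v k = lfrac (- v) k.
Proof. exact: loc_oppE. Qed.
Lemma lfracv0 k : lfrac 0 k = 0.
Proof. exact: lfrac0. Qed.
Lemma lfrac_eq0 v k : lfrac v k = 0 <-> exists e, f ^+ e *: v = 0.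
Proof.
split=> [/lfracP[e]|[e he]]; first by rewrite addn0 scaler0; exists e.
by apply/lfracP; exists e; rewrite addn0 scaler0.
Qed.
Lemma lfrac_sum (J : Type) (r : seq J) (F : J -> V) k :
  lfrac (\sum_(j <- r) F j) k = \sum_(j <- r) lfrac (F j) k.
Proof.
elim/big_rec2: _ => [|j y1 y2 _ <-]; [exact: lfracv0|exact: lfracD1].
Qed.
End Localization.

Section LocMaps.
Variables (A : comNzRingType) (V W : lmodType A).

(* loc_map phi (v / f^k) = phi v / f^k; see loc_mapE. *)
Definition loc_map (f : A) (phi : V -> W) (u : loc f V) : loc f W :=
  lfrac f (phi (lrep u).1) (lrep u).2.

(* The canonical map V_f -> V_h for h = f * c, v / f^k |-> c^k v / h^k (see
   loc_resE); meaningless when h <> f * c. *)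
Definition loc_res (f h c : A) (u : loc f V) : loc h V :=
  lfrac h (c ^+ (lrep u).2 *: (lrep u).1) (lrep u).2.

Lemma loc_mapE (f : A) (phi : {linear V -> W}) v k :
  loc_map phi (lfrac f v k) = lfrac f (phi v) k.
Proof.
rewrite /loc_map; case E: (lrep (lfrac f v k)) => [v' k'] /=.
have /lfracP[e he] : lfrac f v' k' = lfrac f v k by rewrite -[RHS]lrepK E.
by apply/lfracP; exists e; rewrite -!linearZ he.
Qed.
Lemma loc_resE (f h c : A) v k : h = f * c ->
  loc_res h c (lfrac f v k) = lfrac h (c ^+ k *: v) k.
Proof.
move=> hE; rewrite /loc_res; case E: (lrep (lfrac f v k)) => [v' k'] /=.
have /lfracP[e he] : lfrac f v' k' = lfrac f v k by rewrite -[RHS]lrepK E.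
apply/lfracP; exists e; rewrite !scalerA hE !exprMn.
have -> : f ^+ (e + k) * c ^+ (e + k) * c ^+ k' = c ^+ (e + k + k') * f ^+ (e + k).
  by rewrite !exprD; ring.
have -> : f ^+ (e + k') * c ^+ (e + k') * c ^+ k = c ^+ (e + k + k') * f ^+ (e + k').
  by rewrite !exprD; ring.
by rewrite -!scalerA he.
Qed.
Lemma loc_map_is_linear f (phi : {linear V -> W}) : linear (@loc_map f phi).
Proof.
move=> a; elim/locW=> v k; elim/locW=> w l.
have hZ b x : phi (b *: x) = b *: phi x by exact: linearZ.
by rewrite lfracZ lfracD !loc_mapE lfracZ lfracD linearD !hZ.
Qed.
Lemma loc_res_is_linear f h c : h = f * c -> linear (@loc_res f h c).
Proof.
move=> hE a; elim/locW=> v k; elim/locW=> w l.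
rewrite lfracZ lfracD !(loc_resE _ _ hE). rewrite lfracZ lfracD; apply: lfrac_eq => //.
rewrite !scalerDr hE !exprMn !exprD !scalerA; congr (_ *: _ + _ *: _); ring.
Qed.
End LocMaps.

Section GradedModules.
Variables (K : fieldType) (p : nat) (G : zmodType) (w : 'I_p -> G).
Notation A := {mpoly K[p]}.

(* The variable 'X_i has degree w i in the grading group G. *)
Definition mnm_wt (mm : 'X_{1..p}) : G := \sum_i w i *+ mm i.

Definition whomog (g : G) (f : A) : Prop :=
  forall mm, mm \in msupp f -> mnm_wt mm = g.

Lemma whomog1 : whomog 0 1.
Proof.
move=> mm; rewrite -mpolyC1 msuppC oner_eq0 inE => /eqP ->.
by apply: big1 => i _; rewrite mnm0E mulr0n.
Qed.
Lemma whomogM g h f f' : whomog g f -> whomog h f' -> whomog (g + h) (f * f').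
Proof.
move=> hf hf' mm /msuppM_le/allpairsP[[m1 m2] /= [/hf <- /hf' <- ->]].
rewrite /mnm_wt -big_split; apply: eq_bigr => i _.
by rewrite mnmDE mulrnDr.
Qed.
Lemma whomogX g f k : whomog g f -> whomog (g *+ k) (f ^+ k).
Proof.
move=> hf; elim: k => [|k ih]; first exact: whomog1.
by rewrite exprS mulrS; apply: whomogM.
Qed.
Lemma whomogU i : whomog (w i) 'X_i.
Proof.
move=> mm; rewrite msuppX inE => /eqP ->.
rewrite /mnm_wt (bigD1 i) //= big1 => [|j hj]; rewrite mnm1E.
  by rewrite eqxx addr0.
by rewrite eq_sym (negPf hj) mulr0n.
Qed.
Lemma whomog_prod (I : finType) (P : pred I) (d : I -> G) (F : I -> A) :
  (forall i, P i -> whomog (d i) (F i)) -> whomog (\sum_(i | P i) d i) (\prod_(i | P i) F i).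
Proof.
move=> h; elim/big_rec2: _ => [|i f g Pi hf]; first exact: whomog1.
by apply: whomogM => //; apply: h.
Qed.

(* gin g is the homogeneous component of degree g; gin_span and gin_indep say
   that the module is the direct sum of its components. *)
Record gmod := GMod {
  gsort :> lmodType A;
  gin : G -> gsort -> Prop;
  gin0 : forall g, gin g 0;
  ginB : forall g u v, gin g u -> gin g v -> gin g (u - v);
  ginZ : forall g h f v, whomog g f -> gin h v -> gin (g + h) (f *: v);
  gin_span : forall v, exists r : seq gsort,
    (forall x, x \in r -> exists g, gin g x) /\ v = \sum_(x <- r) x;
  gin_indep : forall (s : seq G) (c : G -> gsort), uniq s ->
    (forall g, g \in s -> gin g (c g)) -> \sum_(g <- s) c g = 0 ->
    forall g, g \in s -> c g = 0 }.

Section GTheory.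
Variable V : gmod.
Implicit Types u v : V.
Lemma ginN g v : gin g v -> gin g (- v).
Proof. by move=> h; rewrite -sub0r; apply: ginB => //; apply: gin0. Qed.
Lemma ginD g u v : gin g u -> gin g v -> gin g (u + v).
Proof. by move=> hu hv; rewrite -[v]opprK; apply: ginB => //; apply: ginN. Qed.
Lemma gin_sum g (J : Type) (r : seq J) (P : pred J) (F : J -> V) :
  (forall j, P j -> gin g (F j)) -> gin g (\sum_(j <- r | P j) F j).
Proof. by move=> h; apply: big_ind => //; [exact: gin0|exact: ginD]. Qed.
Lemma ginXZ g h k f v : whomog h f -> gin g v -> gin (g + h *+ k) (f ^+ k *: v).
Proof. by move=> hf hv; rewrite addrC; apply: ginZ => //; apply: whomogX. Qed.
Lemma gin_decomp v : exists (s : seq G) (c : G -> V),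
  [/\ uniq s, forall g, gin g (c g) & v = \sum_(g <- s) c g].
Proof.
have [r [hr ->]] := gin_span v; elim: r hr => [|x r ih] hr.
  by exists [::], (fun _ => 0); split=> // [g|]; rewrite ?big_nil //; apply: gin0.
have [|s [c [us hc e]]] := ih; first by move=> y hy; apply: hr; rewrite inE hy orbT.
have [g hg] := hr x (mem_head _ _); rewrite big_cons e.
case: (boolP (g \in s)) => gs.
  exists s, (fun h => if h == g then x + c h else c h); split=> // [h|].
    by case: eqP => [->|] //; apply: ginD.
  rewrite (bigD1_seq g) //= [RHS](bigD1_seq g) //= eqxx addrA; congr (_ + _).
  by apply: eq_bigr => h /negPf ->.
exists (g :: s), (fun h => if h == g then x else c h); split=> [|h|].
- by rewrite /= gs.
- by case: eqP => [->|].
rewrite big_cons eqxx; congr (_ + _); apply: eq_big_seq => h hs.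
by case: eqP gs => // <-; rewrite hs.
Qed.
End GTheory.

(* Morphisms are homogeneous of degree 0. *)
Record ghom (V W : gmod) := GHom {
  ghfun :> {linear V -> W};
  ghomP : forall g v, gin g v -> gin g (ghfun v) }.

Definition homog_sub (V : gmod) (P : V -> Prop) : Prop :=
  forall (s : seq G) (c : G -> V), uniq s -> (forall g, gin g (c g)) ->
    P (\sum_(g <- s) c g) -> forall g, g \in s -> P (c g).

Section GSub.
Variables (V : gmod) (P : submod V) (hP : homog_sub P).
Definition gsub_in g (z : smod P) := gin g (smod_val z).
Lemma smod_valD (z z' : smod P) : smod_val (z + z') = smod_val z + smod_val z'.
Proof. by []. Qed.
Lemma smod_val_sum (J : Type) (r : seq J) (F : J -> smod P) :
  smod_val (\sum_(j <- r) F j) = \sum_(j <- r) smod_val (F j).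
Proof. by elim/big_rec2: _ => // j y1 y2 _ <-. Qed.
Lemma gsub_in0 g : gsub_in g 0.
Proof. exact: gin0. Qed.
Lemma gsub_inB g u v : gsub_in g u -> gsub_in g v -> gsub_in g (u - v).
Proof. exact: ginB. Qed.
Lemma gsub_inZ g h f v : whomog g f -> gsub_in h v -> gsub_in (g + h) (f *: v).
Proof. exact: ginZ. Qed.
Lemma gsub_span v : exists r : seq (smod P),
    (forall x, x \in r -> exists g, gsub_in g x) /\ v = \sum_(x <- r) x.
Proof.
have [s [c [us hc e]]] := gin_decomp (smod_val v).
have hs g : g \in s -> P (c g).
  by apply: hP => //; rewrite -e; apply/smemP/smod_valP.
exists [seq insubd (0 : smod P) (c g) | g <- s]; split.
  move=> x /mapP[g gs ->]; exists g; rewrite /gsub_in.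
  by rewrite (_ : smod_val _ = c g) // (@insubdK _ _ (smod P)) //; apply/smemP/hs.
apply: val_inj; rewrite big_map /= smod_val_sum e; apply: eq_big_seq => g gs.
by rewrite (@insubdK _ _ (smod P)) //; apply/smemP/hs.
Qed.
Lemma gsub_indep (s : seq G) (c : G -> smod P) : uniq s ->
    (forall g, g \in s -> gsub_in g (c g)) -> \sum_(g <- s) c g = 0 ->
    forall g, g \in s -> c g = 0.
Proof.
move=> us hc h0 g gs; apply: val_inj => /=.
apply: (@gin_indep V s (fun g => smod_val (c g))) => //.
by rewrite -smod_val_sum h0.
Qed.
Definition gsub : gmod := @GMod (smod P) gsub_in gsub_in0 gsub_inB gsub_inZ gsub_span gsub_indep.

Definition gquo_in g (u : qmod P) := exists2 v, gin g v & u = qpi P v.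
Lemma gquo_in0 g : gquo_in g 0.
Proof. by exists 0; [exact: gin0|rewrite qpi0]. Qed.
Lemma gquo_inB g u v : gquo_in g u -> gquo_in g v -> gquo_in g (u - v).
Proof.
move=> [x hx ->] [y hy ->]; exists (x - y); first exact: ginB.
by rewrite qpiD qpiN.
Qed.
Lemma gquo_inZ g h f v : whomog g f -> gquo_in h v -> gquo_in (g + h) (f *: v).
Proof.
by move=> hf [x hx ->]; exists (f *: x); [exact: ginZ|rewrite linearZ].
Qed.
Lemma gquo_span v : exists r : seq (qmod P),
    (forall x, x \in r -> exists g, gquo_in g x) /\ v = \sum_(x <- r) x.
Proof.
have [x <-] := qpi_surj v; have [r [hr e]] := gin_span x.
exists [seq qpi P y | y <- r]; split; last by rewrite e raddf_sum big_map.
by move=> _ /mapP[y /hr[g hg] ->]; exists g; exists y.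
Qed.
Lemma gquo_indep (s : seq G) (c : G -> qmod P) : uniq s ->
    (forall g, g \in s -> gquo_in g (c g)) -> \sum_(g <- s) c g = 0 ->
    forall g, g \in s -> c g = 0.
Proof.
move=> us hc h0.
have /choice[d hd] : forall g, exists x, gin g x /\ (g \in s -> c g = qpi P x).
  move=> g; case: (boolP (g \in s)) => gs.
    by have [x hx e] := hc g gs; exists x.
  by exists 0; split => //; apply: gin0.
have hs : P (\sum_(g <- s) d g).
  rewrite -[X in P X]subr0; apply/qpiE; rewrite qpi0 raddf_sum -[RHS]h0.
  by apply: eq_big_seq => g gs; rewrite (hd g).2.
move=> g gs; rewrite (hd g).2 // -(qpi0 P); apply/qpiE; rewrite subr0.
by apply: (hP us _ hs) => // h; have [] := hd h.
Qed.
Definition gquo : gmod := @GMod (qmod P) gquo_in gquo_in0 gquo_inB gquo_inZ gquo_span gquo_indep.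
End GSub.

Section GKer.
Variables (V W : gmod) (phi : ghom V W).
Lemma ker_sub0 : phi 0 = 0. Proof. exact: linear0. Qed.
Lemma ker_subL a u v : phi u = 0 -> phi v = 0 -> phi (a *: u + v) = 0.
Proof. by move=> hu hv; rewrite linearP hu hv scaler0 addr0. Qed.
Definition ker_sub : submod V := @Submod A V (fun v => phi v = 0) ker_sub0 ker_subL.
Lemma ker_homog : homog_sub ker_sub.
Proof.
move=> s c us hc; rewrite /= raddf_sum => h g gs.
apply: (@gin_indep W s (fun g => phi (c g))) => // h' _; exact/ghomP.
Qed.
Definition gker : gmod := gsub ker_homog.

Lemma im_sub0 : exists u, phi u = 0. Proof. by exists 0; apply: linear0. Qed.
Lemma im_subL a u v : (exists x, phi x = u) -> (exists x, phi x = v) ->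
  exists x, phi x = a *: u + v.
Proof. by move=> [x <-] [y <-]; exists (a *: x + y); rewrite linearP. Qed.
Definition im_sub : submod W := @Submod A W (fun v => exists u, phi u = v) im_sub0 im_subL.
Lemma im_homog : homog_sub im_sub.
Proof.
move=> s c us hc [u hu] g gs.
have [s' [d [us' hd e]]] := gin_decomp u.
pose d' h := if h \in s' then d h else 0.
pose t := undup (s ++ s').
have hd' h : gin h (d' h) by rewrite /d'; case: ifP => // _; apply: gin0.
exists (d' g); apply/esym/eqP; rewrite -subr_eq0; apply/eqP.
pose c' h := if h \in s then c h else 0.
have hc' h : gin h (c' h) by rewrite /c'; case: ifP => // _; apply: gin0.
have ext (U : gmod) (x : G -> U) (r : seq G) : uniq r -> {subset r <= t} ->
  \sum_(h <- t) (if h \in r then x h else 0) = \sum_(h <- r) x h.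
  move=> ur rt; rewrite -big_mkcond -big_filter; apply: perm_big.
  apply: uniq_perm => //; first by rewrite filter_uniq ?undup_uniq.
  by move=> h; rewrite mem_filter; case: (boolP (h \in r)) => //= /rt.
have := @gin_indep W t (fun h => c' h - phi (d' h)); rewrite (_ : c g = c' g); last by rewrite /c' gs.
apply.
- exact: undup_uniq.
- by move=> h _; apply: ginB => //; apply: ghomP.
- rewrite big_split /= sumrN -raddf_sum !ext //.
  + by rewrite -hu e subrr.
  + by move=> h hh; rewrite mem_undup mem_cat hh orbT.
  + by move=> h hh; rewrite mem_undup mem_cat hh.
- by rewrite mem_undup mem_cat gs.
Qed.
End GKer.

Section GProd.
Variables (I : finType) (V : I -> gmod).
Notation T := (prodmod V).
Definition gprod_in g (c : T) := forall i, gin g (prod_pr i c).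
Lemma gprod_in0 g : gprod_in g 0.
Proof. by move=> i; rewrite raddf0; apply: gin0. Qed.
Lemma gprod_inB g u v : gprod_in g u -> gprod_in g v -> gprod_in g (u - v).
Proof. by move=> hu hv i; rewrite raddfB; apply: ginB. Qed.
Lemma gprod_inZ g h f v : whomog g f -> gprod_in h v -> gprod_in (g + h) (f *: v).
Proof. by move=> hf hv i; rewrite linearZ; apply: ginZ. Qed.
Definition prod_inj i (x : V i) : T := prod_mk (dfwith (fun j => 0 : V j) x).
Lemma prod_injE v : v = \sum_i prod_inj (prod_pr i v).
Proof.
apply: prod_eq => j; rewrite prod_pr_sum (bigD1 j) //= big1 => [|i ij].
  by rewrite prod_mkE dfwith_in addr0.
by rewrite prod_mkE dfwith_out.
Qed.
Lemma prod_injD i : {morph @prod_inj i : x y / x + y}.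
Proof.
move=> x y; apply: prod_eq => j; rewrite raddfD /= !prod_mkE.
have [<-|ij] := eqVneq i j; first by rewrite !dfwith_in.
by rewrite !dfwith_out // addr0.
Qed.
Lemma prod_inj0 i : prod_inj (0 : V i) = 0.
Proof.
apply: prod_eq => j; rewrite raddf0 /= prod_mkE.
by have [<-|ij] := eqVneq i j; rewrite ?dfwith_in ?dfwith_out.
Qed.
Lemma prod_inj_in i g (x : V i) : gin g x -> gprod_in g (prod_inj x).
Proof.
move=> hx j; rewrite prod_mkE.
by have [<-|ij] := eqVneq i j; rewrite ?dfwith_in ?dfwith_out //; apply: gin0.
Qed.
Lemma gprod_span v : exists r : seq T,
    (forall x, x \in r -> exists g, gprod_in g x) /\ v = \sum_(x <- r) x.
Proof.
rewrite [v]prod_injE; elim/big_rec: _ => [|i x _ [r [hr ->]]].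
  by exists [::]; rewrite big_nil.
have [r' [hr' ->]] := gin_span (prod_pr i v).
exists ([seq prod_inj y | y <- r'] ++ r); split=> [y|].
  rewrite mem_cat => /orP[/mapP[z /hr'[g hg] ->]|/hr//].
  by exists g; apply: prod_inj_in.
rewrite big_cat big_map /=; congr (_ + _).
by rewrite (big_morph _ (@prod_injD i) (@prod_inj0 i)).
Qed.
Lemma gprod_indep (s : seq G) (c : G -> T) : uniq s ->
    (forall g, g \in s -> gprod_in g (c g)) -> \sum_(g <- s) c g = 0 ->
    forall g, g \in s -> c g = 0.
Proof.
move=> us hc h0 g gs; apply: prod_eq => i; rewrite raddf0.
apply: (@gin_indep (V i) s (fun g => prod_pr i (c g))) => // [h /hc //|].
by rewrite -prod_pr_sum h0 raddf0.
Qed.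
Definition gprod : gmod := @GMod T gprod_in gprod_in0 gprod_inB gprod_inZ gprod_span gprod_indep.
End GProd.

Section GLoc.
Variables (V : gmod) (f : A) (d : G) (hf : whomog d f).
Notation T := (loc f V).
(* v / f^k has degree g when v has degree g + k * deg f. *)
Definition gloc_in g (u : T) :=
  exists v k, gin (g + d *+ k) v /\ u = lfrac f v k.
Lemma gloc_in0 g : gloc_in g 0.
Proof. by exists 0, 0%N; rewrite lfracv0; split=> //; apply: gin0. Qed.
Lemma gloc_inB g u v : gloc_in g u -> gloc_in g v -> gloc_in g (u - v).
Proof.
move=> [x [k [hx ->]]] [y [l [hy ->]]]; exists (f ^+ l *: x + f ^+ k *: - y), (k + l)%N.
rewrite lfracN lfracD; split=> //; rewrite mulrnDr; apply: ginD.
  by rewrite addrA; apply: ginXZ.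
by rewrite [X in g + X]addrC addrA; apply: ginXZ => //; apply: ginN.
Qed.
Lemma gloc_inZ g h a v : whomog g a -> gloc_in h v -> gloc_in (g + h) (a *: v).
Proof.
move=> ha [x [k [hx ->]]]; exists (a *: x), k; rewrite lfracZ; split=> //.
by rewrite -addrA; apply: ginZ.
Qed.
Lemma gloc_span v : exists r : seq T,
    (forall x, x \in r -> exists g, gloc_in g x) /\ v = \sum_(x <- r) x.
Proof.
elim/locW: v => v k; have [r [hr ->]] := gin_span v.
exists [seq lfrac f y k | y <- r]; split; last by rewrite big_map lfrac_sum.
move=> _ /mapP[y /hr[g hg] ->]; exists (g - d *+ k), y, k; split=> //.
by rewrite subrK.
Qed.
Lemma gloc_common (s : seq G) (c : G -> T) :
  (forall g, g \in s -> gloc_in g (c g)) -> exists k (v : G -> V),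
  forall g, g \in s -> gin (g + d *+ k) (v g) /\ c g = lfrac f (v g) k.
Proof.
elim: s => [|g s ih] hc; first by exists 0%N, (fun=> 0).
have [|k [v hv]] := ih; first by move=> h hs; apply: hc; rewrite inE hs orbT.
have [x [l [hx e]]] := hc g (mem_head _ _).
exists (l + k)%N, (fun h => if h == g then f ^+ k *: x else f ^+ l *: v h).
move=> h; rewrite inE; case: eqP => [-> _|_ /= /hv[h1 ->]].
  rewrite e [(l + k)%N]addnC lfrac_expand; split=> //.
  by rewrite addnC mulrnDr addrA; apply: ginXZ.
rewrite lfrac_expand; split=> //.
by rewrite addnC mulrnDr addrA; apply: ginXZ.
Qed.
Lemma gloc_indep (s : seq G) (c : G -> T) : uniq s ->
    (forall g, g \in s -> gloc_in g (c g)) -> \sum_(g <- s) c g = 0 ->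
    forall g, g \in s -> c g = 0.
Proof.
move=> us /gloc_common[k [v hv]] h0 g gs.
have {h0} : lfrac f (\sum_(g <- s) v g) k = 0.
  by rewrite lfrac_sum -[RHS]h0; apply: eq_big_seq => h /hv[].
move=> /lfrac_eq0[e]; rewrite scaler_sumr => h0.
have [_ ->] := hv g gs; apply/lfrac_eq0; exists e.
pose t := d *+ k + d *+ e.
have := @gin_indep V [seq h + t | h <- s] (fun h => f ^+ e *: v (h - t)) _ _ _ (g + t).
rewrite addrK; apply.
- by rewrite map_inj_uniq // => x y /addIr.
- move=> _ /mapP[h hs ->]; rewrite addrK addrA.
  by apply: ginXZ => //; have [] := hv h hs.
- by rewrite big_map -[RHS]h0; apply: eq_bigr => h _; rewrite addrK.
- by apply/mapP; exists g.
Qed.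
Definition gloc : gmod := @GMod T gloc_in gloc_in0 gloc_inB gloc_inZ gloc_span gloc_indep.
End GLoc.
End GradedModules.

Arguments ker_homog {K p G w V W} phi.
Arguments im_homog {K p G w V W} phi.

Section GradedMaps.
Variables (K : fieldType) (p : nat) (G : zmodType) (w : 'I_p -> G).
Notation gmod := (gmod K w).

Definition mk_ghom (V W : gmod) (f : V -> W) (fL : linear f)
    (fD : forall g v, gin g v -> gin g (f v)) : ghom V W :=
  @GHom K p G w V W (HB.pack f (GRing.isLinear.Build _ _ _ _ f fL)) fD.

Lemma ghom_sum (V W : gmod) (f : ghom V W) (J : Type) (r : seq J) (P : pred J) (F : J -> V) :
  f (\sum_(i <- r | P i) F i) = \sum_(i <- r | P i) f (F i).
Proof. exact: raddf_sum. Qed.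
Lemma ghomZ (V W : gmod) (f : ghom V W) a v : f (a *: v) = a *: f v.
Proof. exact: linearZ. Qed.

Section SubMap.
Variables (V W : gmod) (P : submod V) (Q : submod W).
Variables (hP : homog_sub P) (hQ : homog_sub Q).
Variables (f : ghom V W) (hf : forall v, P v -> Q (f v)).

Lemma gsub_map_subproof (z : smod P) : f (smod_val z) \in smem Q.
Proof. exact/smemP/hf/smemP/smod_valP. Qed.
Definition gsub_map_fun (z : gsub hP) : gsub hQ := SMod (gsub_map_subproof z).
Lemma gsub_map_linear : linear gsub_map_fun.
Proof. by move=> a u v; apply: val_inj; rewrite /= linearP. Qed.
Lemma gsub_map_deg g v : gin g v -> gin g (gsub_map_fun v).
Proof. by move=> hv; apply: (ghomP f hv). Qed.
Definition gsub_map : ghom (gsub hP) (gsub hQ) := mk_ghom gsub_map_linear gsub_map_deg.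

Definition gquo_map_fun (u : gquo hP) : gquo hQ := qpi Q (f (repr (u : Quotient.quot (smem P)))).
Lemma gquo_map_funE v : gquo_map_fun (qpi P v) = qpi Q (f v).
Proof.
apply/qpiE; rewrite -linearB; apply: hf; apply/qpiE.
by rewrite /qpi reprK.
Qed.
Lemma gquo_map_linear : linear gquo_map_fun.
Proof.
move=> a u v; have [x <-] := qpi_surj u; have [y <-] := qpi_surj v.
by rewrite -linearP !gquo_map_funE -linearP /= linearP.
Qed.
Lemma gquo_map_deg g v : gin g v -> gin g (gquo_map_fun v).
Proof.
move=> [x hx ->]; rewrite gquo_map_funE; exists (f x) => //; exact: ghomP.
Qed.
Definition gquo_map : ghom (gquo hP) (gquo hQ) := mk_ghom gquo_map_linear gquo_map_deg.
End SubMap.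

Section LocMap.
Variables (V W : gmod) (f : {mpoly K[p]}) (d : G) (hf : whomog w d f) (phi : ghom V W).
Lemma gloc_map_deg g (v : gloc V hf) : gin g v -> gin g (loc_map phi v : gloc W hf).
Proof.
move=> [x [k [hx ->]]]; exists (phi x), k; rewrite loc_mapE; split=> //.
exact: ghomP.
Qed.
Definition gloc_map : ghom (gloc V hf) (gloc W hf) :=
  @mk_ghom (gloc V hf) (gloc W hf) _ (loc_map_is_linear phi) gloc_map_deg.
End LocMap.

Lemma gprod_prP (I : finType) (V : I -> gmod) a (u v : gprod V) i :
  prod_pr i (a *: u + v) = a *: prod_pr i u + prod_pr i v.
Proof. exact: (linearP (prod_pr i)). Qed.

Section ProdMap.
Variables (I : finType) (V W : I -> gmod) (phi : forall i, ghom (V i) (W i)).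
Definition gprod_map_fun (c : gprod V) : gprod W :=
  prod_mk (fun i => phi i (prod_pr i c)).
Lemma gprod_map_linear : linear gprod_map_fun.
Proof.
by move=> a u v; apply: prod_eq => i; rewrite !prod_mkE linearP.
Qed.
Lemma gprod_map_deg g v : gin g v -> gin g (gprod_map_fun v).
Proof. by move=> hv i; rewrite prod_mkE; apply/ghomP/hv. Qed.
Definition gprod_map : ghom (gprod V) (gprod W) := mk_ghom gprod_map_linear gprod_map_deg.
End ProdMap.

Definition zero_sub (V : gmod) : submod V :=
  @Submod {mpoly K[p]} V (fun v => v = 0) erefl
    (fun a u v hu hv => etrans (congr2 (fun x y => a *: x + y) hu hv)
                          (etrans (addr0 _) (scaler0 _ a))).
Lemma zero_homog (V : gmod) : homog_sub (zero_sub V).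
Proof. move=> s c us hc h g; exact: (@gin_indep _ _ _ _ V s c). Qed.

Section Preim.
Variables (V : gmod) (P Q : submod V) (hP : homog_sub P) (hQ : homog_sub Q).
Definition pre_sub : submod (gsub hP) :=
  @Submod {mpoly K[p]} (gsub hP) (fun z => Q (smod_val z)) (spred0 Q)
    (fun a u v hu hv => spredL a hu hv).
Lemma pre_homog : homog_sub pre_sub.
Proof.
move=> s c us hc h g gs.
by apply: (hQ (c := fun g => smod_val (c g)) us _ _ gs) => //; rewrite -smod_val_sum.
Qed.
End Preim.
End GradedMaps.
Arguments pre_homog {K p G w V P Q} hP hQ.


Section Cech.
Variables (K : fieldType) (m n : nat).
Notation S := {mpoly K[m + n]}.

(* The first m variables are x_1, ..., x_m, the last n are y_1, ..., y_n. *)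
Definition bideg (i : 'I_(m + n)) : (int * int)%type :=
  match split i with inl _ => (1, 0) | inr _ => (0, 1) end.

Definition bigraded := gmod K bideg.

Definition ymon (I : {set 'I_n}) : S := \prod_(i in I) 'X_(rshift m i).
Definition ymon_deg (I : {set 'I_n}) : (int * int)%type := \sum_(i in I) bideg (rshift m i).
Lemma ymon_whomog I : whomog bideg (ymon_deg I) (ymon I).
Proof. by apply: whomog_prod => i _; apply: whomogU. Qed.
Arguments ymon_whomog : clear implicits.
Lemma ymonD (I J : {set 'I_n}) : I \subset J -> ymon J = ymon I * ymon (J :\: I).
Proof.
move=> IJ; rewrite /ymon (big_setID I) /=; congr (_ * _); apply: eq_bigl => i.
by rewrite (setIidPr IJ).
Qed.
Lemma ymon_degD (I J : {set 'I_n}) : I \subset J ->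
  ymon_deg J = ymon_deg I + ymon_deg (J :\: I).
Proof.
move=> IJ; rewrite /ymon_deg (big_setID I) /=; congr (_ + _); apply: eq_bigl => i.
by rewrite (setIidPr IJ).
Qed.

(* The Cech complex of V on y_1, ..., y_n: in degree p it is the direct sum
   of the V_(y_I), I ranging over the p-element subsets of {1, ..., n}. *)
Definition cidx (p : nat) := {I : {set 'I_n} | #|I| == p}.

Definition cech (V : bigraded) (p : nat) : bigraded :=
  gprod (fun I : cidx p => gloc V (ymon_whomog (val I))).

(* When J = I + {j}, this is the position of j in J, so that (-1)^(csign I J)
   is the usual Cech sign. *)
Definition csign (I J : {set 'I_n}) : nat :=
  #|[set i in I | [exists j in J :\: I, (i < j)%N]]|.

Definition cdiff_fun (V : bigraded) p (c : cech V p) : cech V p.+1 :=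
  prod_mk (fun J : cidx p.+1 => \sum_(I : cidx p | val I \subset val J)
    (-1) ^+ csign (val I) (val J) *:
      loc_res (ymon (val J)) (ymon (val J :\: val I)) (prod_pr I c)).

Lemma cdiff_funE (V : bigraded) p (c : cech V p) J :
  prod_pr J (cdiff_fun c) = \sum_(I : cidx p | val I \subset val J)
    (-1) ^+ csign (val I) (val J) *:
      loc_res (ymon (val J)) (ymon (val J :\: val I)) (prod_pr I c).
Proof. exact: prod_mkE. Qed.
Lemma scale_linear_comb (W : lmodType S) (s a : S) (x y : W) :
  s *: (a *: x + y) = a *: (s *: x) + s *: y.
Proof. by rewrite scalerDr !scalerA mulrC. Qed.
Lemma cdiff_linear (V : bigraded) p : linear (@cdiff_fun V p).
Proof.
move=> a u v; apply: prod_eq => J.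
refine (etrans _ (esym (gprod_prP a (cdiff_fun u) (cdiff_fun v) J))).
rewrite !cdiff_funE scaler_sumr -big_split; apply: eq_bigr => I IJ.
set s := (-1) ^+ _.
refine (etrans (congr1 (fun z => s *: loc_res _ _ z) (gprod_prP a u v I)) _).
refine (etrans (congr1 (fun z => s *: z) (loc_res_is_linear (ymonD IJ) a _ _)) _).
exact: scale_linear_comb.
Qed.
Lemma gin_sgn (V : bigraded) g (v : V) k : gin g v -> gin g ((-1) ^+ k *: v).
Proof. by move=> hv; rewrite -signr_odd; case: (odd k); rewrite ?expr0 ?expr1 ?scale1r ?scaleN1r //; apply: ginN. Qed.
Lemma cdiff_deg (V : bigraded) p g v : gin g v -> gin g (@cdiff_fun V p v).
Proof.
move=> hv J; rewrite cdiff_funE; apply: gin_sum => I IJ; apply: gin_sgn.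
have [x [k [hx ->]]] := hv I; rewrite (loc_resE _ _ (ymonD IJ)).
exists (ymon (val J :\: val I) ^+ k *: x), k; split=> //.
rewrite (ymon_degD IJ) mulrnDl addrA; apply: ginXZ => //; exact: ymon_whomog.
Qed.
Definition cdiff (V : bigraded) p : ghom (cech V p) (cech V p.+1) :=
  mk_ghom (@cdiff_linear V p) (@cdiff_deg V p).

Definition cobnd (V : bigraded) (p : nat) : submod (cech V p) :=
  match p with 0 => zero_sub _ | q.+1 => im_sub (cdiff V q) end.
Lemma cobnd_homog V p : homog_sub (cobnd V p).
Proof. by case: p => [|p]; [exact: zero_homog|exact: im_homog]. Qed.

(* Local cohomology H^p_Q(V) with support in Q = (y_1, ..., y_n), with the
   bigrading coming from the Cech complex. *)
Definition lcoh (p : nat) (V : bigraded) : bigraded :=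
  gquo (pre_homog (ker_homog (cdiff V p)) (@cobnd_homog V p)).

Section Map.
Variables (V W : bigraded) (phi : ghom V W).
Definition cech_map p : ghom (cech V p) (cech W p) :=
  gprod_map (fun I : cidx p => gloc_map (ymon_whomog (val I)) phi).
Lemma cech_mapE p c I : prod_pr I (cech_map p c) = loc_map phi (prod_pr I c).
Proof. by rewrite prod_mkE. Qed.
Lemma cdiffE U p c J : prod_pr J (cdiff U p c) = \sum_(I : cidx p | val I \subset val J)
    (-1) ^+ csign (val I) (val J) *:
      loc_res (ymon (val J)) (ymon (val J :\: val I)) (prod_pr I c).
Proof. exact: cdiff_funE. Qed.
Lemma loc_map_res (f h c : S) (u : loc f V) : h = f * c ->
  loc_map phi (loc_res h c u) = loc_res h c (loc_map phi u).
Proof.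
move=> hE; elim/locW: u => v k.
by rewrite (loc_resE _ _ hE) !loc_mapE (loc_resE _ _ hE) linearZ.
Qed.
Lemma cech_map_diff p c : cdiff W p (cech_map p c) = cech_map p.+1 (cdiff V p c).
Proof.
apply: prod_eq => J; rewrite cech_mapE !cdiffE.
refine (esym (etrans (ghom_sum (gloc_map (ymon_whomog (val J)) phi) _ _ _) _)).
apply: eq_bigr => I IJ.
refine (etrans (ghomZ (gloc_map (ymon_whomog (val J)) phi) _ _) _).
refine (congr1 (fun z => _ *: z) _).
rewrite cech_mapE; exact: (loc_map_res _ (ymonD IJ)).
Qed.
Lemma cech_map_ker p c : ker_sub (cdiff V p) c -> ker_sub (cdiff W p) (cech_map p c).
Proof.
move=> hc; exact: (etrans (cech_map_diff c) (etrans (congr1 (cech_map p.+1) hc) (linear0 _))).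
Qed.
Lemma cech_map_bnd p c : cobnd V p c -> cobnd W p (cech_map p c).
Proof.
case: p c => [c ->|p c [b <-]]; first exact: linear0.
exists (cech_map p b); exact: cech_map_diff.
Qed.
Definition cyc_map p := gsub_map (ker_homog (cdiff V p)) (ker_homog (cdiff W p)) (@cech_map_ker p).
Definition lcoh_map p : ghom (lcoh p V) (lcoh p W) :=
  gquo_map (pre_homog _ (@cobnd_homog V p)) (pre_homog _ (@cobnd_homog W p)) (f := cyc_map p)
   (fun z hz => cech_map_bnd hz).
End Map.
End Cech.

(* For a bigraded module V, the graded K[x]-module V_j, direct sum over k of
   the components of degree (k, j). *)
Section Strand.
Variables (K : fieldType) (m n : nat).
Notation S := {mpoly K[m + n]}.
Definition xdeg (i : 'I_m) : int := 1.
Definition graded := gmod K xdeg.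

Definition x_incl : {rmorphism {mpoly K[m]} -> S} :=
  comp_mpoly [tuple 'X_(lshift n i) | i < m].

Section Obj.
Variables (j : int) (V : bigraded K m n).
Notation T := (restr x_incl V).
Definition strand_pred (v : T) : Prop := exists r : seq V,
  (forall x, x \in r -> exists k, gin (k, j) x) /\ (v : V) = \sum_(x <- r) x.

Lemma mnm_wt_x (mm : 'X_{1..m}) : mnm_wt xdeg mm = \sum_(i < m) (mm i)%:Z.
Proof. by apply: eq_bigr => i _; rewrite natz. Qed.
Lemma x_incl_whomog k f : whomog xdeg k f -> whomog (@bideg m n) (k, 0) (x_incl f).
Proof.
move=> hf; rewrite /= comp_mpolyEX big_seq; elim/big_ind: _ => [mm|f1 f2 h1 h2 mm|mm hmm].
- by rewrite msupp0.
- by move=> /msuppD_le; rewrite mem_cat => /orP[/h1|/h2].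
move=> m0 /msuppZ_le; apply: (_ : whomog _ _ _).
rewrite comp_mpolyX -(hf _ hmm).
have -> : (mnm_wt xdeg mm, 0) = \sum_(i < m) ((mm i)%:Z, 0 : int).
  rewrite mnm_wt_x; elim/big_rec2: _ => // i x y _ <-.
  by congr pair; rewrite addr0.
apply: whomog_prod => i _; rewrite tnth_mktuple.
have -> : ((mm i)%:Z, 0 : int) = bideg (lshift n i) *+ mm i.
  rewrite /bideg; case: splitP => [i' _|i' /= e]; last by have := ltn_ord i; rewrite e -ltn_subRL subnn.
  by elim: (mm i) => // l ih; rewrite mulrS -ih /=; congr pair; rewrite ?addr0 // intS.
exact/whomogX/whomogU.
Qed.

Lemma strand_pred0 : strand_pred 0.
Proof. by exists [::]; rewrite big_nil. Qed.
Lemma strand_predD u v : strand_pred u -> strand_pred v -> strand_pred (u + v).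
Proof.
move=> [r [hr ->]] [r' [hr' ->]]; exists (r ++ r'); rewrite big_cat; split=> // x.
by rewrite mem_cat => /orP[/hr|/hr'].
Qed.
Lemma strand_predZ a u : strand_pred u -> strand_pred (a *: u).
Proof.
move=> [r [hr ->]].
have e : x_incl a *: (\sum_(x <- r) x : V) =
    \sum_(mm <- msupp a) \sum_(x <- r) x_incl (a@_mm *: 'X_[mm]) *: (x : V).
  rewrite {1}[a]mpolyE (raddf_sum x_incl) scaler_suml.
  by apply: eq_bigr => mm _; rewrite scaler_sumr.
rewrite -[X in strand_pred X]/(x_incl a *: (\sum_(x <- r) x : V)) e.
elim/big_ind: _ => [||mm _]; [exact: strand_pred0|exact: strand_predD|].
rewrite big_seq; elim/big_ind: _ => [||x hx]; [exact: strand_pred0|exact: strand_predD|].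
have [k hk] := hr x hx.
exists [:: x_incl (a@_mm *: 'X_[mm]) *: (x : V)]; rewrite big_seq1; split=> // y.
rewrite inE => /eqP ->; exists (mnm_wt xdeg mm + k).
rewrite (_ : (_, j) = (mnm_wt xdeg mm, 0) + (k, j)); last by congr pair; rewrite add0r.
apply: ginZ => //; apply: x_incl_whomog => m0 /msuppZ_le.
by rewrite msuppX inE => /eqP ->.
Qed.
Definition strand_sub : submod T := @Submod {mpoly K[m]} T strand_pred strand_pred0
  (fun a u v hu hv => strand_predD (strand_predZ a hu) hv).

Definition strand_in k (z : smod strand_sub) : Prop := @gin _ _ _ _ V (k, j) (smod_val z).
Lemma strand_in0 k : strand_in k 0. Proof. exact: (@gin0 _ _ _ _ V). Qed.
Lemma strand_inB k u v : strand_in k u -> strand_in k v -> strand_in k (u - v).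
Proof. exact: (@ginB _ _ _ _ V). Qed.
Lemma strand_inZ k l f v : whomog xdeg k f -> strand_in l v -> strand_in (k + l) (f *: v).
Proof.
move=> /x_incl_whomog hf hv; rewrite /strand_in.
rewrite (_ : (_, j) = (k, 0) + (l, j)); last by congr pair; rewrite add0r.
exact: ginZ hf hv.
Qed.
Lemma strand_val_sum (J : Type) (r : seq J) (F : J -> smod strand_sub) :
  smod_val (\sum_(i <- r) F i) = \sum_(i <- r) (smod_val (F i) : V).
Proof. by elim/big_rec2: _ => // i y1 y2 _ <-. Qed.
Lemma strand_span v : exists r : seq (smod strand_sub),
  (forall x, x \in r -> exists k, strand_in k x) /\ v = \sum_(x <- r) x.
Proof.
have [r [hr e]] : strand_pred (smod_val v) by apply/(smemP strand_sub)/smod_valP.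
have hs x : x \in r -> x \in smem strand_sub.
  by move=> hx; apply/smemP; exists [:: x]; rewrite big_seq1; split=> // y; rewrite inE => /eqP ->; apply: hr.
exists [seq insubd (0 : smod strand_sub) x | x <- r]; split.
  move=> _ /mapP[y hy ->]; have [k hk] := hr y hy; exists k; rewrite /strand_in.
  by rewrite (_ : smod_val _ = y) // (@insubdK _ _ (smod strand_sub)) // hs.
apply: val_inj; rewrite big_map /= strand_val_sum [LHS]e; apply: eq_big_seq => x hx.
by rewrite (@insubdK _ _ (smod strand_sub)) // hs.
Qed.
Lemma strand_indep (s : seq int) (c : int -> smod strand_sub) : uniq s ->
    (forall g, g \in s -> strand_in g (c g)) -> \sum_(g <- s) c g = 0 ->
    forall g, g \in s -> c g = 0.
Proof.
move=> us hc h0 k ks; apply: val_inj => /=.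
have := @gin_indep _ _ _ _ V [seq (k, j) | k <- s] (fun g => smod_val (c g.1)) _ _ _ (k, j).
apply.
- by rewrite map_inj_uniq // => x y [].
- by move=> _ /mapP[x xs ->]; apply: hc.
- by rewrite big_map /= -strand_val_sum h0.
- by apply/mapP; exists k.
Qed.
Definition strand : graded :=
  @GMod K m int xdeg (smod strand_sub) strand_in strand_in0 strand_inB strand_inZ strand_span strand_indep.
End Obj.

Section StrandMap.
Variables (j : int) (V W : bigraded K m n) (phi : ghom V W).
Lemma strand_map_subproof (z : strand j V) : (phi (smod_val z) : restr x_incl W) \in smem (strand_sub j W).
Proof.
have [r [hr e]] : strand_pred j (smod_val z) by apply/(smemP (strand_sub j V))/smod_valP.
apply/smemP; exists [seq phi x | x <- r]; rewrite e big_map raddf_sum; split=> //.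
by move=> _ /mapP[x /hr[k hk] ->]; exists k; apply: ghomP.
Qed.
Definition strand_map_fun (z : strand j V) : strand j W := SMod (strand_map_subproof z).
Lemma strand_map_linear : linear strand_map_fun.
Proof. by move=> a u v; apply: val_inj; apply: (linearP phi (x_incl a)). Qed.
Lemma strand_map_deg k v : gin k v -> gin k (strand_map_fun v).
Proof. by move=> hv; apply: (ghomP phi hv). Qed.
Definition strand_map : ghom (strand j V) (strand j W) := mk_ghom strand_map_linear strand_map_deg.
End StrandMap.
End Strand.

Section Resolutions.
Variables (K : fieldType) (p : nat) (G : zmodType) (w : 'I_p -> G).
Notation A := {mpoly K[p]}.
Notation gmod := (gmod K w).

Definition is_zero (V : gmod) : Prop := forall v : V, v = 0.

Definition fin_gen (V : gmod) : Prop := exists (r : nat) (b : 'I_r -> V),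
  forall v, exists c : {ffun 'I_r -> A}, v = \sum_i c i *: b i.

(* Finitely generated graded free: there is a finite homogeneous basis. *)
Definition fg_free (V : gmod) : Prop := exists (r : nat) (b : 'I_r -> V) (d : 'I_r -> G),
  (forall i, gin (d i) (b i)) /\
  forall v, exists! c : {ffun 'I_r -> A}, v = \sum_i c i *: b i.

Definition exact_at (U V W : gmod) (f : ghom U V) (g : ghom V W) : Prop :=
  forall v, g v = 0 <-> exists u, f u = v.

(* 0 -> F_len -> ... -> F_0 -> M -> 0, padded with F_i = 0 for i > len. *)
Definition free_resolution (len : nat) (F : nat -> gmod) (d : forall i, ghom (F i.+1) (F i))
    (M : gmod) (eps : ghom (F 0) M) : Prop :=
  [/\ forall i, fg_free (F i),
      forall x, exists v, eps v = x,
      exact_at (d 0) eps,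
      forall i, exact_at (d i.+1) (d i) &
      forall i, (len < i)%N -> is_zero (F i)].

Section Tail.
Variables (C : nat -> gmod) (d : forall i, ghom (C i.+1) (C i)).

Definition full_sub (V : gmod) : submod V :=
  @Submod A V (fun=> True) I (fun _ _ _ _ _ => I).
(* The kernel of C_i -> C_(i-1), where C_(-1) = 0. *)
Definition cyc_sub (i : nat) : submod (C i) :=
  match i with 0 => full_sub (C 0) | k.+1 => ker_sub (d k) end.
Lemma cyc_homog i : homog_sub (cyc_sub i).
Proof. by case: i => [//|i]; apply: ker_homog. Qed.
Definition cycles (i : nat) : gmod := gsub (@cyc_homog i).

Variables (i : nat) (Z : gmod) (d0 : ghom (C i.+1) Z).
(* The complex ... -> C_(i+2) -> C_(i+1) -> Z, with Z in degree 0. *)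
Definition tail (k : nat) : gmod := match k with 0 => Z | k'.+1 => C (k'.+1 + i) end.
Definition tail_diff (k : nat) : ghom (tail k.+1) (tail k) :=
  match k return ghom (tail k.+1) (tail k) with
  | 0 => d0 | k'.+1 => d (k'.+1 + i) end.
End Tail.
End Resolutions.

(* cd(Q, M) = c. Under the convention cd(Q, 0) = -oo, the zero module has no
   cohomological dimension here. *)
Definition is_cd (K : fieldType) (m n : nat) (M : bigraded K m n) (c : nat) : Prop :=
  ~ is_zero (lcoh c M) /\ forall i, (c < i)%N -> is_zero (lcoh i M).

(* Main.v *)
Require Import Defs.
From HB Require Import structures.
From mathcomp Require Import all_boot all_order all_algebra.
From mathcomp Require Import boolp mpoly zify ring.

(** The double complex X_i^p = Cech^p(F_i) has exact rows for p > 0, because M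
    is Q-torsion and so all its localizations M_(y_I), I nonempty, vanish; its
    row p = 0 resolves M.  Its columns are exact except at p = n, where the
    cohomology is H^n_Q(F_i).  Chasing down the diagonals gives exactness of
    the H^n_Q(F_i) away from i = n and identifies Ker / Im with M at i = n.  The
    part C_n -> ... -> C_0 -> 0 is then an exact complex of graded free
    modules, so Ker psi_n is graded free by Gaussian elimination.

    That M is Q-torsion when H^i_Q(M) = 0 for i > 0 follows by comparing the
    Cech and Koszul complexes: M = H^0_Q(M) + QM, and Nakayama applies in the
    y-grading, which is bounded below. *)

Set Implicit Arguments.
Unset Strict Implicit.
Unset Printing Implicit Defensive.

Import GRing.Theory.
Local Open Scope ring_scope.

(** * Homogeneous components *)

Section HomogeneousComponents.
Variables (K : fieldType) (p : nat) (G : zmodType) (w : 'I_p -> G).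
Notation A := {mpoly K[p]}.
Notation gmod := (gmod K w).

(** Localizations are avoided as far as possible. A Cech cochain is written with numerators over one
    common exponent, v_I / y_I^k; its differential is then the Koszul differential of y_1^k, ...,
    y_n^k, and a cocycle becomes a Koszul cocycle of numerators once k is large. For a free module
    this is a question about S in each coordinate, where dividing by y_i^k and dropping the
    remainder contracts the Koszul complex.

    Each stair of the diagonal chase from H^n_Q(F_n) to M involves a choice. The correspondence is
    therefore carried as a linear relation and becomes a morphism only once the partner of each
    cycle is known to be unique. Degrees survive because any chosen preimage of a homogeneous
    element can be replaced by its component of the same degree.

    The y-grading of M is bounded below because M is a quotient of F_0, and S has no negative
    degrees. The strands of H^n_Q(F_i) have finite rank because only finitely many y-monomials with
    all exponents negative have a given total degree. *)

Definition hdecomp (V : gmod) (v : V) (c : G -> V) :=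
  (forall g, gin g (c g)) /\
  exists s : seq G, [/\ uniq s, forall g, g \notin s -> c g = 0 & v = \sum_(g <- s) c g].

Lemma sum_widen (V : zmodType) (c : G -> V) (s t : seq G) : uniq s -> uniq t ->
  {subset s <= t} -> (forall g, g \notin s -> c g = 0) ->
  \sum_(g <- s) c g = \sum_(g <- t) c g.
Proof.
move=> us ut st hc; rewrite [RHS](bigID (mem s)) /= [X in _ + X]big1 ?addr0; last first.
  by move=> g; apply: hc.
rewrite -[RHS]big_filter; apply: perm_big; apply: uniq_perm => //.
  by rewrite filter_uniq.
by move=> g; rewrite mem_filter; case: (boolP (g \in s)) => // /st ->.
Qed.

Lemma hdecomp_exists (V : gmod) (v : V) : exists c, hdecomp v c.
Proof.
have [s [c [us hc e]]] := gin_decomp v.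
exists (fun g => if g \in s then c g else 0); split=> [g|].
  by case: ifP => // _; apply: gin0.
exists s; split=> // [g /negPf ->//|].
by rewrite e; apply: eq_big_seq => g ->.
Qed.

Definition hcomp (V : gmod) (g : G) (v : V) : V := projT1 (cid (hdecomp_exists v)) g.

Lemma hcompP (V : gmod) (v : V) : hdecomp v (fun g => hcomp g v).
Proof. exact: projT2 (cid (hdecomp_exists v)). Qed.

Lemma gin_hcomp (V : gmod) g (v : V) : gin g (hcomp g v).
Proof. by have [] := hcompP v. Qed.

Lemma hcomp_unique (V : gmod) (v : V) c : hdecomp v c -> forall g, hcomp g v = c g.
Proof.
move=> [hc1 [s [us s0 es]]] g; have [hc2 [t [ut t0 et]]] := hcompP v.
pose r := undup (g :: s ++ t).
have ur : uniq r by apply: undup_uniq.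
have sr : {subset s <= r}.
  by move=> x xs; rewrite mem_undup inE mem_cat xs orbT.
have tr : {subset t <= r}.
  by move=> x xs; rewrite mem_undup inE mem_cat xs !orbT.
apply/eqP; rewrite -subr_eq0; apply/eqP.
apply: (@gin_indep _ _ _ _ V r (fun g => hcomp g v - c g)) => //.
- by move=> x _; apply: ginB.
- rewrite sumrB -(sum_widen us ur sr s0) -(sum_widen ut ur tr t0) -es -et.
  exact: subrr.
- by rewrite mem_undup inE eqxx.
Qed.

Lemma hdecomp_homog (V : gmod) g (v : V) : gin g v -> hdecomp v (fun h => if h == g then v else 0).
Proof.
move=> hv; split=> [h|]; first by case: eqP => [->//|_]; apply: gin0.
exists [:: g]; split=> // [h|]; first by rewrite inE => /negPf ->.
by rewrite big_seq1 eqxx.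
Qed.

Lemma hcomp_homog (V : gmod) g h (v : V) : gin g v -> hcomp h v = if h == g then v else 0.
Proof. by move=> /hdecomp_homog /hcomp_unique ->. Qed.

Lemma hcomp_id (V : gmod) g (v : V) : gin g v -> hcomp g v = v.
Proof. by move=> /hcomp_homog ->; rewrite eqxx. Qed.

Lemma hdecompD (V : gmod) (u v : V) c d :
  hdecomp u c -> hdecomp v d -> hdecomp (u + v) (fun g => c g + d g).
Proof.
move=> [hc1 [s [us s0 es]]] [hd1 [t [ut t0 et]]]; split=> [g|]; first exact: ginD.
pose r := undup (s ++ t).
have ur : uniq r by apply: undup_uniq.
have sr : {subset s <= r}.
  by move=> x xs; rewrite mem_undup mem_cat xs.
have tr : {subset t <= r}.
  by move=> x xs; rewrite mem_undup mem_cat xs !orbT.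
exists r; split=> // [g|].
  by rewrite mem_undup mem_cat negb_or => /andP[/s0 -> /t0 ->]; rewrite addr0.
by rewrite es et (sum_widen us ur sr s0) (sum_widen ut ur tr t0) big_split.
Qed.

Lemma hcompD (V : gmod) g (u v : V) : hcomp g (u + v) = hcomp g u + hcomp g v.
Proof. exact: (hcomp_unique (hdecompD (hcompP u) (hcompP v))). Qed.

Lemma hcomp0 (V : gmod) g : hcomp g (0 : V) = 0.
Proof. by apply/hcomp_id/gin0. Qed.

Lemma hcompN (V : gmod) g (v : V) : hcomp g (- v) = - hcomp g v.
Proof. by apply/eqP; rewrite -subr_eq0 opprK -hcompD addNr hcomp0. Qed.

Lemma hcomp_sum (V : gmod) g (J : Type) (r : seq J) (P : pred J) (F : J -> V) :
  hcomp g (\sum_(i <- r | P i) F i) = \sum_(i <- r | P i) hcomp g (F i).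
Proof. exact: (big_morph _ (@hcompD V g) (hcomp0 V g)). Qed.

Lemma hcomp_ghom (V W : gmod) (f : ghom V W) g (v : V) : hcomp g (f v) = f (hcomp g v).
Proof.
have [h1 [s [us s0 es]]] := hcompP v.
apply: (hcomp_unique (c := fun g => f (hcomp g v))); split=> [h|]; first exact: ghomP.
exists s; split=> // [h /s0 ->|]; first exact: linear0.
by rewrite {1}es ghom_sum.
Qed.

Lemma hcompZ (V : gmod) g h (a : A) (v : V) : whomog w h a -> hcomp (h + g) (a *: v) = a *: hcomp g v.
Proof.
move=> ha; have [h1 [s [us s0 es]]] := hcompP v.
pose c g' := a *: hcomp (g' - h) v.
rewrite (_ : a *: hcomp g v = c (h + g)); last by rewrite /c addrC addrA addNr add0r.
apply: (hcomp_unique (c := c)); split=> [g'|].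
  by rewrite -{1}[g'](subrK h) addrC; apply: ginZ.
exists [seq h + x | x <- s]; split.
- by rewrite map_inj_uniq // => x y /addrI.
- move=> g' hg'; rewrite /c s0 ?scaler0 //; apply: contra hg' => hs.
  by apply/mapP; exists (g' - h) => //; rewrite addrC subrK.
rewrite big_map {1}es scaler_sumr; apply: eq_bigr => x _.
by rewrite /c [h + x]addrC addrK.
Qed.

Lemma hcomp_span (V : gmod) (v : V) : exists2 s : seq G, uniq s & v = \sum_(g <- s) hcomp g v.
Proof. by have [_ [s [us _ es]]] := hcompP v; exists s. Qed.

Lemma ghomB (V W : gmod) (f : ghom V W) (u v : V) : f (u - v) = f u - f v.
Proof. exact: linearB. Qed.

Lemma ghomD (V W : gmod) (f : ghom V W) (u v : V) : f (u + v) = f u + f v.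
Proof. exact: linearD. Qed.

Lemma ghom0 (V W : gmod) (f : ghom V W) : f 0 = 0.
Proof. exact: linear0. Qed.

(** Keeps the diagonal chases inside one degree: morphisms commute with [hcomp], so a component of
    any preimage is a preimage. *)
Lemma homog_lift (V W : gmod) (f : ghom V W) g (v : V) : gin g (f v) ->
  exists2 u, gin g u & f u = f v.
Proof. by move=> hv; exists (hcomp g v); [exact: gin_hcomp | rewrite -hcomp_ghom hcomp_id]. Qed.

End HomogeneousComponents.

(** * Koszul and Cech complexes *)

(** The terms at (i, l) and (l, i) cancel, in any characteristic. This is the cancellation behind
    [koszul_dd] and [koszul_bb]. *)
Lemma antisym_sum (n : nat) (V : zmodType) (J : {set 'I_n}) (g : 'I_n -> 'I_n -> V) :
  {in J &, forall i l, i != l -> g i l = - g l i} ->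
  \sum_(i in J) \sum_(l in J | l != i) g i l = 0.
Proof.
move=> hg; rewrite (eq_bigr (fun i : 'I_n => \sum_(l in J | (i < l)%N) g i l -
   \sum_(l in J | (l < i)%N) g l i)) => [|i iJ].
  rewrite sumrB [X in _ - X](exchange_big_dep (mem J)) /=; last by move=> i j iJ /andP[].
  apply/eqP; rewrite subr_eq0; apply/eqP. by apply: eq_bigr => i iJ; apply: eq_bigl => l; rewrite iJ.
rewrite (bigID (fun l : 'I_n => (i < l)%N)) /= -sumrN; congr (_ + _).
  by apply: eq_bigl => l; rewrite -andbA; congr (_ && _); rewrite -val_eqE /=; lia.
rewrite (eq_bigl (fun l : 'I_n => (l \in J) && (l < i)%N)) => [|l]; last first.
  by rewrite -andbA; congr (_ && _); rewrite -val_eqE /=; lia.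
by apply: eq_bigr => l /andP[lJ li]; apply: hg => //; rewrite -val_eqE /=; lia.
Qed.

Section KoszulSigns.
Variables (R : comNzRingType) (n : nat).
Implicit Types (I J : {set 'I_n}) (i l : 'I_n).

(** Only elements strictly below [i] count, so [J], [J :\ i] and [i |: J] give the same sign, and
    [koszul_d] and [koszul_b] can share it. *)
Definition ksgn i J : R := (-1) ^+ #|[set l in J | (l < i)%N]|.

Lemma ksgnD1 i J : ksgn i (J :\ i) = ksgn i J.
Proof.
congr (_ ^+ #|pred_of_set _|); apply/setP => l; rewrite !inE -val_eqE /=.
by case: (l \in J); rewrite ?andbF //=; lia.
Qed.

Lemma ksgn_del l i J : l \in J -> i != l ->
  ksgn i J = (if (l < i)%N then -1 else 1) * ksgn i (J :\ l).
Proof.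
move=> lJ il; rewrite /ksgn (cardsD1 l) !inE lJ /= exprD; congr (_ * _).
  by case: (l < i)%N; rewrite ?expr1 ?expr0.
by congr (_ ^+ _); apply: eq_card => k; rewrite !inE andbA.
Qed.

Lemma ksgn_sqr i J : ksgn i J * ksgn i J = 1.
Proof. by rewrite -expr2 sqrr_sign. Qed.

(** Deleting the smaller of the two indices flips the sign of the larger one; deleting the larger
    leaves the other sign alone. *)
Lemma ksgn_anti i l J : i \in J -> l \in J -> i != l ->
  ksgn i J * ksgn l (J :\ i) = - (ksgn l J * ksgn i (J :\ l)).
Proof.
move=> iJ lJ il; rewrite (ksgn_del lJ il) [ksgn l J](ksgn_del iJ); last by rewrite eq_sym.
case: (ltngtP l i) => [_|_|/val_inj e]; [ring|ring|by rewrite e eqxx in il].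
Qed.

Lemma csign_del i J : i \in J -> (-1) ^+ csign (J :\ i) J = ksgn i J.
Proof.
move=> iJ; rewrite -ksgnD1 /ksgn /csign; congr (_ ^+ #|pred_of_set _|).
apply/setP => l; rewrite !inE; congr (_ && _).
apply/existsP/idP => [[k]|li]; last by exists i; rewrite !inE iJ li eqxx.
by rewrite !inE => /andP[/andP[]]; rewrite negb_and negbK => /orP[/eqP -> //|/negPf ->].
Qed.
End KoszulSigns.

Section KoszulCech.
Variables (K : fieldType) (m n : nat).
Notation S := {mpoly K[m + n]}.
Notation y i := ('X_(rshift m i) : S).
Notation ymon := (@ymon K m n).
Notation cidx := (cidx n).

Section Koszul.
Variable V : lmodType S.
Implicit Types v : {set 'I_n} -> V.

(* The Koszul cochain complex of y_1^k, ..., y_n^k on V, all degrees at once. *)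
Definition koszul_d (k : nat) v (J : {set 'I_n}) : V :=
  \sum_(i in J) (ksgn S i J * y i ^+ k) *: v (J :\ i).

Lemma koszul_dd k v J : koszul_d k (koszul_d k v) J = 0.
Proof.
rewrite -[RHS](antisym_sum (J := J) (g := fun i l =>
  (ksgn S i J * y i ^+ k * (ksgn S l (J :\ i) * y l ^+ k)) *: v (J :\ i :\ l))).
  apply: eq_bigr => i iJ; rewrite scaler_sumr.
  by apply: eq_big => [l|l _]; rewrite ?inE 1?andbC // scalerA.
move=> i l iJ lJ il; rewrite setDDl setUC -setDDl -scaleNr; congr (_ *: _).
have := ksgn_anti S iJ lJ il; set a := ksgn _ _ _; set b := ksgn _ _ _.
set c := ksgn _ _ _; set e := ksgn _ _ _ => h.
have -> : a * y i ^+ k * (b * y l ^+ k) = (a * b) * (y i ^+ k * y l ^+ k) by ring.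
by rewrite h; ring.
Qed.

(** Passing from v_I / y_I^k to the equal fraction with exponent e + k is compatible with the Koszul
    differentials. *)
Lemma koszul_d_scale k e v J :
  koszul_d (e + k) (fun I => ymon I ^+ e *: v I) J = ymon J ^+ e *: koszul_d k v J.
Proof.
rewrite /koszul_d scaler_sumr; apply: eq_bigr => i iJ; rewrite !scalerA; congr (_ *: _).
have -> : ymon J = y i * ymon (J :\ i) by rewrite /ymon (big_setD1 i).
by rewrite exprMn exprD; ring.
Qed.

(** The boundary of the Koszul chain complex of y_1, ..., y_n, a chain being the family of its
    coefficients. *)
Definition koszul_b v (J : {set 'I_n}) : V :=
  \sum_(i in ~: J) (ksgn S i J * y i) *: v (i |: J).

Lemma koszul_bb v J : koszul_b (koszul_b v) J = 0.
Proof.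
rewrite -[RHS](antisym_sum (J := ~: J) (g := fun i l =>
  (ksgn S i J * y i * (ksgn S l (i |: J) * y l)) *: v (l |: (i |: J)))).
  apply: eq_bigr => i iJ; rewrite scaler_sumr.
  by apply: eq_big => [l|l _]; rewrite ?inE ?negb_or 1?andbC // scalerA.
move=> i l; rewrite !inE => iJ lJ il; rewrite setUCA -scaleNr; congr (_ *: _).
have := @ksgn_anti S _ l i (l |: (i |: J)).
rewrite !inE !eqxx orbT eq_sym => /(_ isT isT il).
have eA : (l |: (i |: J)) :\ l = i |: J.
  by rewrite setU1K // !inE negb_or lJ eq_sym il.
have eB : (l |: (i |: J)) :\ i = l |: J.
  by rewrite setUCA setU1K // !inE negb_or iJ il.
rewrite eA eB -[ksgn S l (l |: _)]ksgnD1 eA -[ksgn S i (l |: _)]ksgnD1 eB.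
have := @ksgnD1 S _ i (i |: J); rewrite setU1K // => <-.
have := @ksgnD1 S _ l (l |: J); rewrite setU1K // => <-.
set a := ksgn _ _ _; set b := ksgn _ _ _.
set c := ksgn _ _ _; set e := ksgn _ _ _ => h.
have -> : b * y i * (a * y l) = (a * b) * (y i * y l) by ring.
by rewrite h; ring.
Qed.

Lemma koszul_d_support (p : nat) k v (J : {set 'I_n}) : (forall I : {set 'I_n}, #|I| != p -> v I = 0) ->
  #|J| != p.+1 -> koszul_d k v J = 0.
Proof.
move=> hv hJ; apply: big1 => i iJ; rewrite hv ?scaler0 //.
by move: hJ; rewrite (cardsD1 i) iJ.
Qed.
End Koszul.

Lemma sum_cidx p (W : zmodType) (F : {set 'I_n} -> W) (J : cidx p.+1) :
  \sum_(I : cidx p | val I \subset val J) F (val I) = \sum_(i in val J) F (val J :\ i).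
Proof.
transitivity (\sum_(I in (fun i => val J :\ i) @: val J) F I); last first.
  apply: big_imset => i l iJ lJ /setP/(_ i); rewrite !inE eqxx iJ andbT /=.
  by case: eqP.
have /= <- := @big_sub_cond _ _ _ {set 'I_n} (fun I => #|I| == p)
  (fun I => I \subset val J) F.
apply: eq_bigl => I; apply/andP/imsetP => [[/eqP cI sI]|[i iJ ->]].
  have : #|val J :\: I| = 1%N.
    by rewrite cardsD (setIidPr sI) cI (eqP (valP J)) subSnn.
  move=> /eqP/cards1P[i ei]; exists i.
    by have := set11 i; rewrite -ei !inE => /andP[].
  by rewrite -ei setDDr setDv set0U (setIidPr sI).
rewrite subsetDl; split=> //.
by have := eqP (valP J); rewrite (cardsD1 i) iJ add1n => -[/eqP].
Qed.

(** * Cech cochains as numerators over a common denominator *)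

Section Cech.
Variable V : bigraded K m n.
Implicit Types v : {set 'I_n} -> V.

(** Values of [v] off the p-element sets are ignored, so that one type of families serves all
    degrees. *)
Definition cfrac p v (k : nat) : cech V p :=
  prod_mk (fun I : cidx p => lfrac (ymon (val I)) (v (val I)) k).

Lemma cfracE p v k (I : cidx p) :
  prod_pr I (cfrac p v k) = lfrac (ymon (val I)) (v (val I)) k.
Proof. exact: prod_mkE. Qed.

Lemma eq_cfrac p v v' k : (forall I : {set 'I_n}, #|I| = p -> v I = v' I) -> cfrac p v k = cfrac p v' k.
Proof.
by move=> h; apply: prod_eq => I; rewrite !cfracE h //; apply/eqP/(valP I).
Qed.

Lemma cfrac_expand p e v k : cfrac p (fun I => ymon I ^+ e *: v I) (e + k) = cfrac p v k.
Proof. by apply: prod_eq => I; rewrite !cfracE lfrac_expand. Qed.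

Lemma cfracZD p a u v k : cfrac p (fun I => a *: u I + v I) k = a *: cfrac p u k + cfrac p v k.
Proof.
apply: prod_eq => I.
refine (etrans _ (esym (gprod_prP a (cfrac p u k) (cfrac p v k) I))).
by rewrite !cfracE lfracD1 lfracZ.
Qed.

Lemma cfrac0 p k : cfrac p (fun _ => 0) k = 0.
Proof. by apply: prod_eq => I; rewrite cfracE lfracv0 raddf0. Qed.

Lemma cfrac_eq0 p v k : cfrac p v k = 0 <->
  forall I : {set 'I_n}, #|I| = p -> exists e, ymon I ^+ e *: v I = 0.
Proof.
split=> [h I /eqP cI|h].
  apply/(lfrac_eq0 _ _ k).
  by rewrite -(cfracE v k (exist _ I cI : cidx p)) h raddf0.
apply: prod_eq => I; rewrite cfracE raddf0; apply/lfrac_eq0/h.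
exact/eqP/(valP I).
Qed.

Lemma cech_frac p (c : cech V p) : exists k v,
  c = cfrac p v k /\ forall I : {set 'I_n}, #|I| != p -> v I = 0.
Proof.
pose kk (I : cidx p) := (lrep (prod_pr I c)).2.
pose k := (\sum_I kk I)%N.
have kkk I : (kk I <= k)%N by rewrite /k (bigD1 I) //= leq_addr.
exists k, (fun I => match insub I with
  | Some I' => ymon I ^+ (k - kk I')%N *: (lrep (prod_pr (I' : cidx p) c)).1
  | None => 0 end); split.
  apply: prod_eq => I; rewrite cfracE valK -{1}(lrepK (prod_pr I c)).
  by rewrite -(lfrac_expand _ (k - kk I)%N) -/(kk I) subnK.
by move=> I hI; rewrite insubN.
Qed.

(** Enlarging the denominator from the k-th power of y_(J - i) to that of y_J multiplies the
    numerator by y_i^k, the coefficient in [koszul_d k]. *)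
Lemma cdiff_cfrac p v k : cdiff V p (cfrac p v k) = cfrac p.+1 (koszul_d k v) k.
Proof.
apply: prod_eq => J; rewrite cfracE; refine (etrans (cdiffE _ _) _).
pose F (I : {set 'I_n}) : loc (ymon (val J)) V := (-1) ^+ csign I (val J) *:
  lfrac (ymon (val J)) (ymon (val J :\: I) ^+ k *: v I) k.
transitivity (\sum_(I : cidx p | val I \subset val J) F (val I)).
  apply: eq_bigr => I IJ; rewrite /F; congr (_ *: _).
  by rewrite cfracE (loc_resE _ _ (ymonD _ _ IJ)).
rewrite sum_cidx [RHS](big_morph (fun x => lfrac _ x k) (fun x y => lfracD1 _ x y k) (lfracv0 _ _ k)).
apply: eq_bigr => i iJ; rewrite /F lfracZ; congr lfrac.
rewrite csign_del // scalerA; congr (_ * _ ^+ _ *: _).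
by rewrite setDDr setDv set0U (setIidPr _) ?sub1set // /ymon big_set1.
Qed.

Lemma cdiff_cdiff p (c : cech V p) : cdiff V p.+1 (cdiff V p c) = 0.
Proof.
have [k [v [-> _]]] := cech_frac c; rewrite !cdiff_cfrac -(cfrac0 p.+2 k).
by apply: eq_cfrac => I _; apply: koszul_dd.
Qed.

(* A Cech cycle becomes a Koszul cycle over a large enough common denominator. *)
Lemma cech_cycle p (c : cech V p) : cdiff V p c = 0 -> exists k v,
  [/\ c = cfrac p v k, forall I : {set 'I_n}, #|I| != p -> v I = 0 & forall J, koszul_d k v J = 0].
Proof.
have [k [v [-> hv]]] := cech_frac c; rewrite cdiff_cfrac => /cfrac_eq0 h.
have /choice[ee hee] : forall J : {set 'I_n}, exists e, ymon J ^+ e *: koszul_d k v J = 0.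
  move=> J; have [/h//|hJ] := eqVneq #|J| p.+1.
  by exists 0%N; rewrite (koszul_d_support _ hv) ?scaler0.
pose e := (\sum_J ee J)%N.
have eee J : (ee J <= e)%N by rewrite /e (bigD1 J) //= leq_addr.
exists (e + k)%N, (fun I => ymon I ^+ e *: v I); split.
- by rewrite cfrac_expand.
- by move=> I /hv ->; rewrite scaler0.
by move=> J; rewrite koszul_d_scale -(subnK (eee J)) exprD -scalerA hee scaler0.
Qed.

End Cech.

Lemma cech_map_cfrac (V W : bigraded K m n) (f : ghom V W) p (v : {set 'I_n} -> V) k :
  cech_map f p (cfrac p v k) = cfrac p (fun I => f (v I)) k.
Proof.
apply: prod_eq => I; refine (etrans (cech_mapE _ _ _) _).
by rewrite !cfracE loc_mapE.
Qed.
End KoszulCech.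

(** * Diagonal chases in a double complex *)

Section DoubleComplex.
Variables (K : fieldType) (p0 : nat) (G : zmodType) (w : 'I_p0 -> G).
Notation gmod := (gmod K w).
Variables (X : nat -> nat -> gmod) (M : gmod) (n : nat).
Variables (d : forall i p, ghom (X i p) (X i p.+1)).
Variables (f : forall i p, ghom (X i.+1 p) (X i p)).
Variable (eps : ghom (X 0 0) M).

Definition bnd i p : X i p -> Prop :=
  match p with 0 => fun x => x = 0 | q.+1 => fun x => exists y, d i q y = x end.

Hypothesis fd : forall i p x, f i p.+1 (d i.+1 p x) = d i p (f i p x).
Hypothesis dd : forall i p x, d i p.+1 (d i p x) = 0.
Hypothesis col_exact : forall i p x, (p < n)%N -> d i p x = 0 -> bnd x.
Hypothesis row_exact : forall i p, exact_at (f i.+1 p) (f i p).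
Hypothesis row_surj : forall p x, exists y, f 0 p.+1 y = x.
Hypothesis eps_exact : exact_at (f 0 0) eps.
Hypothesis eps_surj : forall x, exists y, eps y = x.

Lemma ff i p x : f i p (f i.+1 p x) = 0.
Proof. by apply/row_exact; exists x. Qed.

Lemma bnd_cycle i p (x : X i p) : bnd x -> d i p x = 0.
Proof. by case: p x => [x ->|p x [y <-]]; [exact: linear0|exact: dd]. Qed.

Lemma bnd0 i p : bnd (0 : X i p).
Proof. by case: p => [//|p]; exists 0; exact: linear0. Qed.

(* x represents a cycle of the complex formed by the cohomologies of d. *)
Definition mod_cycle i p : X i p -> Prop :=
  match i return X i p -> Prop with 0 => fun _ => True | k.+1 => fun x => bnd (f k p x) end.

(** The induction goes down the diagonal through (i, p). Off the main diagonal it ends in row 0 at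
    some i > 0, where that row is exact, or at i = 0 in a row p > 0, where [row_surj] applies. Only
    the main diagonal ends at (0, 0), where M is the obstruction. *)
Lemma off_diagonal_exact p i (x : X i p) : (p <= n)%N -> i != p ->
  mod_cycle x ->
  exists y, bnd (x - f i p y).
Proof.
elim: p i x => [|p IH] [|i] x pn // ip hx.
- have [y hy] : exists y, f i.+1 0 y = x by apply/row_exact.
  by exists y; rewrite hy subrr; apply: bnd0.
- have [y hy] := row_surj x.
  by exists y; rewrite hy subrr; apply: bnd0.
have [c hc] := hx.
(* [c] is again a cycle modulo boundaries: d (f c) = f (f x) = 0, and the column is exact there. *)
have [||y hy] := IH i c (ltnW pn); first by rewrite eqSS in ip.
  case: i x c hc ip hx => [//|i] x c hc ip hx.
  by apply: col_exact => //; rewrite -fd hc ff.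
(* The correction works because f (x - d y) = d (c - f y), and c - f y is a boundary. *)
have e : f i p.+1 (x - d i.+1 p y) = 0.
  apply/eqP; rewrite linearB /= fd -hc -linearB /=; apply/eqP.
  exact: bnd_cycle.
have [y' hy'] : exists y', f i.+1 p.+1 y' = x - d i.+1 p y by apply/row_exact.
by exists y', y; rewrite hy' opprB addrCA subrr addr0.
Qed.

(** The staircase joining X p p to M. It is a relation because [c'] is determined only up to a cycle
    of the column. *)
Fixpoint diag_rel p : X p p -> M -> Prop :=
  match p with
  | 0 => fun c x => eps c = x
  | q.+1 => fun c x => exists2 c', f q q.+1 c = d q q c' & diag_rel c' x
  end.

Lemma diag_relP p a (c c' : X p p) x x' :
  diag_rel c x -> diag_rel c' x' -> diag_rel (a *: c + c') (a *: x + x').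
Proof.
elim: p c c' => [|p IH] c c' /=; first by move=> <- <-; rewrite linearP.
move=> [b hb rb] [b' hb' rb']; exists (a *: b + b'); last exact: IH.
by rewrite !linearP hb hb'.
Qed.

Lemma diag_rel0 p : diag_rel (0 : X p p) 0.
Proof.
elim: p => [|p IH] /=; first exact: linear0.
by exists 0 => //; rewrite !linear0.
Qed.

(** The correction is that of [off_diagonal_exact]; at (0, 0) the assumption that [c] is related to
    0 takes the place of row exactness or surjectivity. *)
Lemma diag_rel_inj p (c : X p p) : (p <= n)%N -> diag_rel c 0 ->
  exists y, bnd (c - f p p y).
Proof.
elim: p c => [|p IH] c pn /=.
  by move=> /eps_exact[y hy]; exists y; rewrite hy subrr.
move=> [b hb rb]; have [y hy] := IH b (ltnW pn) rb.
have e : f p p.+1 (c - d p.+1 p y) = 0.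
  apply/eqP; rewrite linearB /= fd hb -linearB /=; apply/eqP.
  exact: bnd_cycle.
have [y' hy'] : exists y', f p.+1 p.+1 y' = c - d p.+1 p y by apply/row_exact.
by exists y', y; rewrite hy' opprB addrCA subrr addr0.
Qed.

(** Single-valuedness modulo boundaries and the image of f. If c = f y + d b and f c = d c', then d
    (c' - f b) = f (f y) = 0, so c' equals f b modulo boundaries, and the situation repeats one
    stair lower. *)
Lemma diag_rel_fun p (c : X p p) y x : (p <= n)%N -> bnd (c - f p p y) -> diag_rel c x -> x = 0.
Proof.
elim: p c y => [|p IH] c y pn /=.
  move=> /eqP; rewrite subr_eq0 => /eqP -> <-; apply/eps_exact; by exists y.
move=> [b hb] [c' hc rc].
have e : d p p (c' - f p p b) = 0.
  rewrite linearB /= -hc -fd hb linearB /= ff subr0.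
  exact: subrr.
exact: (IH c' b (ltnW pn) (col_exact pn e) rc).
Qed.

Lemma diag_rel_mod_cycle p (c : X p p) x : diag_rel c x -> mod_cycle c.
Proof. by case: p c => [//|p] c [c' hc _]; exists c'. Qed.

Lemma diag_rel_surj p (x : M) : exists c : X p p, diag_rel c x.
Proof.
elim: p => [|p [c hc]] /=; first exact: eps_surj.
(* Either the row is surjective (p = 0), or d c is a cycle of its row because f c is itself a
   boundary. *)
have [c' hc'] : exists c', f p p.+1 c' = d p p c.
  case: p c hc => [|p] c hc; first exact: row_surj.
  apply/row_exact; rewrite fd; case: hc => b -> _; exact: dd.
by exists c', c.
Qed.

Lemma diag_rel_total_homog p g (c : X p p) : (p <= n)%N -> gin g c ->
  mod_cycle c ->
  exists2 x, gin g x & diag_rel c x.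
Proof.
elim: p c => [|p IH] c pn hc /=; first by exists (eps c) => //; apply: ghomP.
move=> [b0 hb0]; have [|b hb e] := @homog_lift _ _ _ _ _ _ (d p p) g b0.
  by rewrite hb0; apply: ghomP.
have [|x hx rx] := IH b (ltnW pn) hb; last by exists x => //; exists b; rewrite ?e.
case: p c pn hc b b0 hb0 hb e IH => [//|p] c pn hc b b0 hb0 hb e IH.
by apply: col_exact => //; rewrite -fd e hb0 ff.
Qed.
End DoubleComplex.

(** * Acyclic bounded modules are torsion *)

Section Torsion.
Variables (K : fieldType) (m n : nat).
Notation S := {mpoly K[m + n]}.
Notation y i := ('X_(rshift m i) : S).
Notation ymon := (@ymon K m n).

Lemma ymon0 : ymon set0 = 1.
Proof. by rewrite /ymon big_set0. Qed.

Lemma ymon1 i : ymon [set i] = y i.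
Proof. by rewrite /ymon big_set1. Qed.

Lemma bideg_y i : @bideg m n (rshift m i) = (0, 1).
Proof.
rewrite /bideg; case: splitP => [j /= e|//].
by have := ltn_ord j; rewrite -e -[X in (_ < X)%N]addn0 ltn_add2l ltn0.
Qed.

Lemma cech_large (V : bigraded K m n) p (c : cech V p) : (n < p)%N -> c = 0.
Proof.
move=> np; apply: prod_eq => I; suff : (p <= n)%N by rewrite leqNgt np.
by rewrite -(eqP (valP I)) -[X in (_ <= X)%N]card_ord max_card.
Qed.

Lemma cfrac_sum (V : bigraded K m n) p (J : Type) (r : seq J) (P : pred J) (a : J -> S)
    (v : J -> {set 'I_n} -> V) k :
  cfrac p (fun I => \sum_(i <- r | P i) a i *: v i I) k =
  \sum_(i <- r | P i) a i *: cfrac p (v i) k.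
Proof.
elim: r => [|i r IH].
  by rewrite big_nil -(cfrac0 V p k); apply: eq_cfrac => I _; rewrite big_nil.
rewrite big_cons -IH; case: ifP => Pi; last first.
  by apply: eq_cfrac => I _; rewrite big_cons Pi.
by rewrite -cfracZD; apply: eq_cfrac => I _; rewrite big_cons Pi.
Qed.

Lemma cech0_const (V : bigraded K m n) (c : cech V 0) : exists a, c = cfrac 0 (fun _ => a) 0.
Proof.
have [k [v [-> _]]] := cech_frac c; exists (v set0).
rewrite -(cfrac_expand 0 k (fun=> v set0) 0); apply: prod_eq => I; rewrite !cfracE.
have I0 : val I = set0 by apply/eqP; rewrite -cards_eq0; apply: (valP I).
apply: lfrac_eq; first by rewrite addn0.
by rewrite I0 ymon0 expr1n scale1r.
Qed.

Section Acyclic.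
Variable M : bigraded K m n.
Hypothesis acyclic : forall p (c : cech M p.+1), cdiff M p.+1 c = 0 ->
  exists b, cdiff M p b = c.

Definition ytorsion (v : M) := forall i, exists e, y i ^+ e *: v = 0.

(* The elements v / y_A, A in {1, ..., n}, link v to the double complex
   Koszul (x) Cech: [d] of the one on A is the Koszul boundary of the larger ones. *)
Definition diag_frac (v : M) p (A : {set 'I_n}) : cech M p :=
  cfrac p (fun I => if I == A then v else 0) 1.

(** Both sides live on the sets A + {i} with i outside A and have numerator y_i v there, with the
    same sign. This is why [diag_frac] has exponent 1. *)
Lemma cdiff_diag_frac v p A : cdiff M p (diag_frac v p A) = koszul_b (diag_frac v p.+1) A.
Proof.
rewrite cdiff_cfrac /koszul_b -cfrac_sum; apply: eq_cfrac => J _.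
rewrite /koszul_d big_mkcond [RHS]big_mkcond; apply: eq_bigr => i _; rewrite inE.
have [iJ|iJ] := boolP (i \in J); have [iA|iA] := boolP (i \in A) => //=.
- case: eqP => [e|_]; last by rewrite scaler0.
  by rewrite -e !inE eqxx in iA.
- rewrite expr1 -ksgnD1; have [e|e] := eqVneq (J :\ i) A.
    by rewrite -e setD1K // eqxx.
  case: eqP => [e'|_]; last by rewrite !scaler0.
  by rewrite e' setU1K ?eqxx in e.
- case: eqP => [e'|_]; last by rewrite scaler0.
  by rewrite e' !inE eqxx in iJ.
Qed.

Lemma cdiff_koszul_b p (u : {set 'I_n} -> cech M p) A :
  cdiff M p (koszul_b u A) = koszul_b (fun B => cdiff M p (u B)) A.
Proof. by rewrite ghom_sum; apply: eq_bigr => i _; rewrite ghomZ. Qed.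

Lemma koszul_bB p (u v : {set 'I_n} -> cech M p) A :
  koszul_b (fun B => u B - v B) A = koszul_b u A - koszul_b v A.
Proof. by rewrite /koszul_b -sumrB; apply: eq_bigr => i _; rewrite scalerBr. Qed.

(** Descending induction from p = n, where the next Cech module is 0. Acyclicity writes the cocycle
    at p as d u', and [u'] corrects the fractions one degree lower because the Koszul boundary
    squares to 0. *)
Lemma diag_frac_lift v p : (p <= n)%N -> exists u : {set 'I_n} -> cech M p,
  forall A, cdiff M p (diag_frac v p A - koszul_b u A) = 0.
Proof.
move=> pn; rewrite -(subKn pn); elim: (n - p)%N (leq_subr p n) => [|q IH] qn.
  by exists (fun _ => 0) => A; apply: cech_large; rewrite subn0.
have [u hu] := IH (ltnW qn).
have e : (n - q = (n - q.+1).+1)%N by lia.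
move: u hu; rewrite e => u hu.
have /choice[u' hu'] := fun A => acyclic (hu A).
exists u' => A; rewrite ghomB cdiff_diag_frac cdiff_koszul_b.
have -> : koszul_b (fun B => cdiff M (n - q.+1) (u' B)) A =
    koszul_b (fun B => diag_frac v (n - q.+1).+1 B - koszul_b u B) A.
  by apply: eq_bigr => i _; rewrite hu'.
by rewrite koszul_bB koszul_bb subr0 subrr.
Qed.

(** The case p = 0, A = set0 of [diag_frac_lift]: the fraction is [v] itself, the Koszul boundary is
    a combination of the y_i, and a Cech 0-cocycle is a torsion element. *)
Lemma acyclic_torsion_mod v : exists a : 'I_n -> M, ytorsion (v - \sum_i y i *: a i).
Proof.
have [u /(_ set0)] := diag_frac_lift v (leq0n n).
have /choice[b hb] := fun A => cech0_const (u A).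
pose a i := ksgn S i set0 *: b [set i].
rewrite (_ : _ - _ = cfrac 0 (fun _ => v - \sum_i y i *: a i) 0) => [h|].
  exists a => i; move: h; rewrite cdiff_cfrac => /cfrac_eq0/(_ [set i]).
  rewrite cards1 => /(_ erefl)[e he]; exists e.
  move: he; rewrite /koszul_d big_set1 expr0 mulr1 ymon1.
  move/(congr1 (fun x => ksgn S i [set i] *: x)).
  by rewrite scaler0 !scalerA mulrAC ksgn_sqr mul1r.
have -> : diag_frac v 0 set0 = cfrac 0 (fun=> v) 0.
  apply: prod_eq => I; rewrite !cfracE.
  have I0 : val I = set0 by apply/eqP; rewrite -cards_eq0; apply: (valP I).
  by apply/lfracP; exists 0%N; rewrite I0 eqxx ymon0 !expr1n.
rewrite -[_ - _]addrC -scaleN1r /koszul_b.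
rewrite (eq_bigr (fun i => (ksgn S i set0 * y i) *: cfrac 0 (fun=> b [set i]) 0)).
  rewrite -cfrac_sum -cfracZD; apply: eq_cfrac => I _.
  rewrite scaleN1r addrC; congr (_ - _).
  by apply: eq_big => [i|i _]; rewrite ?inE // scalerA mulrC.
by move=> i _; rewrite setU0 hb.
Qed.
End Acyclic.

Lemma ytorsion0 (M : bigraded K m n) : @ytorsion M 0.
Proof. by move=> i; exists 0%N; rewrite scaler0. Qed.

Lemma ytorsionD (M : bigraded K m n) (u v : M) : ytorsion u -> ytorsion v -> ytorsion (u + v).
Proof.
move=> hu hv i; have [e he] := hu i; have [e' he'] := hv i; exists (e + e')%N.
by rewrite scalerDr {1}[(e + e')%N]addnC !exprD -!scalerA he he' !scaler0 addr0.
Qed.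

Lemma ytorsionZ (M : bigraded K m n) a (v : M) : ytorsion v -> ytorsion (a *: v).
Proof. by move=> hv i; have [e he] := hv i; exists e; rewrite scalerA mulrC -scalerA he scaler0. Qed.

(* Nakayama's lemma in the y-grading, for M modulo its torsion. *)
Lemma bounded_acyclic_torsion (M : bigraded K m n) (t0 : int) :
  (forall g (v : M), gin g v -> (g.2 < t0)%R -> v = 0) ->
  (forall p (c : cech M p.+1), cdiff M p.+1 c = 0 -> exists b, cdiff M p b = c) ->
  forall v : M, ytorsion v.
Proof.
move=> bd acyc v.
have hom k : forall g (x : M), gin g x -> (g.2 < t0 + k%:Z)%R -> ytorsion x.
  elim: k => [|k IH] g x hx hg.
    by rewrite (bd g x) //; [exact: ytorsion0|rewrite addr0 in hg].
  have [a ha] := acyclic_torsion_mod acyc x.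
  pose g' := g - (0, 1).
  (* The coefficients a_i may be replaced by their components of degree g - (0, 1), which fall under
     the induction hypothesis. *)
  have e : hcomp g (x - \sum_i y i *: a i) = x - \sum_i y i *: hcomp g' (a i).
    rewrite hcompD hcomp_id //; congr (_ + _).
    rewrite hcompN hcomp_sum; congr (- _); apply: eq_bigr => i _.
    rewrite -[in LHS](subrK (0, 1) g) -/g' addrC hcompZ // -(bideg_y i).
    exact: whomogU.
  rewrite -[x](subrK (\sum_i y i *: hcomp g' (a i))) -e.
  apply: ytorsionD.
    move=> i; have [l hl] := ha i; exists l.
    rewrite -(@hcompZ _ _ _ _ _ g ((0, 1) *+ l)) ?hl ?hcomp0 //.
    by rewrite -(bideg_y i); apply/whomogX/whomogU.
  apply: big_ind => [|z z' hz hz'|i _]; [exact: ytorsion0|exact: ytorsionD|].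
  apply/ytorsionZ/(IH g'); first exact: gin_hcomp.
  by have -> : g'.2 = g.2 - 1 by []; lia.
have [s _ ->] := hcomp_span v.
apply: big_ind => [|z z' hz hz'|g _]; [exact: ytorsion0|exact: ytorsionD|].
by apply: (hom (absz (g.2 - t0)).+1 g); [exact: gin_hcomp|lia].
Qed.
End Torsion.

(** * Cech cohomology of free modules *)

Section MonomialQuotient.
Variables (K : fieldType) (N : nat).
Implicit Types (f g : {mpoly K[N]}) (u v k : 'X_{1..N}).

Lemma mcoeffMXE f u k :
  (f * 'X_[u])@_k = if (u <= k)%MM then f@_(k - u) else 0.
Proof.
case: ifP => h; first by have := mcoeffMX f u (k - u)%MM; rewrite addmC submK.
apply/eqP; rewrite mcoeff_eq0; apply/negP => /msuppM_le/allpairsP[[a b] /= [_]].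
rewrite msuppX inE => /eqP -> e; move/negP: h; apply; apply/mnm_lepP => i.
by rewrite e mnmDE leq_addl.
Qed.

(** The left inverse of multiplication by X^u that kills every monomial not divisible by X^u. It
    commutes with monomials in the other variables, which makes it usable in a contracting
    homotopy. *)
Definition mquoX u f : {mpoly K[N]} :=
  \sum_(k <- msupp f | (u <= k)%MM) f@_k *: 'X_[k - u].

Lemma mcoeff_quoX u f k : (mquoX u f)@_k = f@_(k + u).
Proof.
rewrite /mquoX raddf_sum /=.
rewrite (eq_bigr (fun l => f@_l * (l == k + u)%MM%:R)) => [|l ul]; last first.
  rewrite mcoeffZ mcoeffX; congr (_ * (nat_of_bool _)%:R).
  by apply/eqP/eqP => [<-|->]; rewrite ?addmK // submK.
have [kf|kf] := boolP ((k + u)%MM \in msupp f); last first.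
  rewrite (memN_msupp_eq0 kf) big1_seq // => l /andP[_ lf].
  by case: eqP => [e|_]; rewrite ?mulr0 // -e lf in kf *.
have uk : (u <= k + u)%MM by apply/mnm_lepP => i; rewrite mnmDE leq_addl.
rewrite -big_filter (bigD1_seq (k + u)%MM) ?filter_uniq ?mem_filter ?uk ?kf //=.
rewrite eqxx mulr1 big1 ?addr0 // => l /negPf ->; exact: mulr0.
Qed.

Lemma mquoX_is_additive u : additive (mquoX u).
Proof. by move=> f g; apply/mpolyP => k; rewrite mcoeffB !mcoeff_quoX mcoeffB. Qed.
HB.instance Definition _ u := GRing.isAdditive.Build _ _ (mquoX u) (mquoX_is_additive u).

Lemma mquoX_mulX u f : mquoX u ('X_[u] * f) = f.
Proof. by apply/mpolyP => k; rewrite mcoeff_quoX addmC mulrC mcoeffMX. Qed.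

Lemma mquoX_mul u v f : (forall i, (u i == 0) || (v i == 0)%N) ->
  mquoX u ('X_[v] * f) = 'X_[v] * mquoX u f.
Proof.
move=> uv; apply/mpolyP => k; rewrite mcoeff_quoX ![_ * f]mulrC ![_ * mquoX _ _]mulrC.
rewrite !mcoeffMXE mcoeff_quoX.
have -> : (v <= k + u)%MM = (v <= k)%MM.
  apply/mnm_lepP/mnm_lepP => h i; have := h i; have := uv i; rewrite mnmDE; lia.
case: ifP => // /mnm_lepP h; congr (_@_ _); apply/mnmP => i.
by rewrite !(mnmDE, mnmBE); have := h i; lia.
Qed.

Lemma mquoX_sign u (e : nat) f : mquoX u ((-1) ^+ e * f) = (-1) ^+ e * mquoX u f.
Proof.
by rewrite -signr_odd; case: (odd e); rewrite ?expr0 ?expr1 ?mul1r ?mulN1r ?raddfN.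
Qed.
End MonomialQuotient.

Section FreeCoordinates.
Variables (K : fieldType) (p : nat) (G : zmodType) (w : 'I_p -> G).
Notation A := {mpoly K[p]}.

Lemma fg_free_coord (V : gmod K w) : fg_free V -> exists (r : nat) (b : 'I_r -> V)
  (d : 'I_r -> G) (co : 'I_r -> V -> A),
  [/\ forall i, gin (d i) (b i),
      forall i a x y, co i (a *: x + y) = a * co i x + co i y,
      forall x, x = \sum_i co i x *: b i &
      forall c i, co i (\sum_l c l *: b l) = c i].
Proof.
move=> [r [b [d [hd hb]]]].
have /choice[co hco] : forall x, exists c : {ffun 'I_r -> A}, x = \sum_i c i *: b i.
  by move=> x; have [c [hc _]] := hb x; exists c.
have uniq_co x (c : {ffun 'I_r -> A}) : x = \sum_i c i *: b i -> co x = c.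
  by move=> hx; have [c0 [_ u]] := hb x; rewrite -(u c hx) -(u (co x) (hco x)).
exists r, b, d, (fun i x => co x i); split=> // [i a x y|c i].
  rewrite (uniq_co _ [ffun i => a * co x i + co y i]) ?ffunE //.
  rewrite {1}[x]hco {1}[y]hco scaler_sumr -big_split; apply: eq_bigr => l _.
  by rewrite ffunE scalerDl scalerA.
rewrite (uniq_co _ [ffun i => c i]) ?ffunE //.
by apply: eq_bigr => l _; rewrite ffunE.
Qed.
End FreeCoordinates.

(** * Exactness of the Koszul complex of y_1^k, ..., y_n^k below the top degree *)

Section KoszulExact.
Variables (K : fieldType) (m n : nat).
Notation S := {mpoly K[m + n]}.
Notation y i := ('X_(rshift m i) : S).
Notation ymon := (@ymon K m n).

Lemma koszul_dB (V : lmodType S) k (u v : {set 'I_n} -> V) J :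
  koszul_d k (fun I => u I - v I) J = koszul_d k u J - koszul_d k v J.
Proof. by rewrite /koszul_d -sumrB; apply: eq_bigr => i _; rewrite scalerBr. Qed.

Notation T := (S^o : lmodType S).
Variable k : nat.
Implicit Types v : {set 'I_n} -> T.
Notation q i := (mquoX (U_(rshift m i) *+ k)%MM).

Lemma yXE i : y i ^+ k = 'X_[U_(rshift m i) *+ k].
Proof. exact: mpolyXn. Qed.

(** For a cocycle v, v - d (h v) vanishes on every set without [i]; on a set containing [i] it keeps
    the part of v not divisible by y_i^k, so coefficients that were already 0 stay 0. *)
Definition koszul_h i v (J : {set 'I_n}) : T :=
  if i \in J then 0 else ksgn S i J * q i (v (i |: J)).

Lemma koszul_homotopy_in i v (J : {set 'I_n}) : i \in J ->
  koszul_d k (koszul_h i v) J = y i ^+ k * q i (v J).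
Proof.
move=> iJ; rewrite /koszul_d (bigD1 i) //= big1 => [|l /andP[lJ li]]; last first.
  by rewrite /koszul_h !inE iJ eq_sym li scaler0.
rewrite addr0 /koszul_h !inE eqxx /= setD1K // ksgnD1.
rewrite -[_ *: _]/((_ : S) * (_ : S)); have h := ksgn_sqr S i J.
rewrite mulrACA h mul1r //.
Qed.

Lemma mquoX_ksgn u (f : S) i (J : {set 'I_n}) :
  mquoX u (ksgn S i J * f) = ksgn S i J * mquoX u f.
Proof. exact: mquoX_sign. Qed.

Lemma koszul_homotopy_out i v (J : {set 'I_n}) : i \notin J -> koszul_d k v (i |: J) = 0 ->
  koszul_d k (koszul_h i v) J = v J.
Proof.
move=> iJ; rewrite {1}/koszul_d big_setU1 //= setU1K //.
move=> /(congr1 (q i)); rewrite raddf0 raddfD raddf_sum /=.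
rewrite -[X in q i X]/((_ : S) * (_ : S)) -mulrA mquoX_ksgn {1}yXE mquoX_mulX.
have eD : ksgn S i (i |: J) = ksgn S i J by rewrite -ksgnD1 setU1K.
rewrite eD => /(congr1 (fun x => ksgn S i J * x)).
rewrite mulrDr mulrA ksgn_sqr mul1r mulr0 => /eqP; rewrite addr_eq0 => /eqP ->.
rewrite mulr_sumr -sumrN /koszul_d; apply: eq_bigr => l lJ.
have il : i != l by apply: contraNneq iJ => ->.
have iJl : i \notin J :\ l by rewrite !inE (negPf iJ) andbF.
rewrite /koszul_h (negPf iJl) -![_ *: _]/((_ : S) * (_ : S)).
have eU : (i |: J) :\ l = i |: (J :\ l).
  by apply/setP => x; rewrite !inE; case: eqP => [->|]; rewrite ?(negPf il) //= eq_sym (negPf il).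
rewrite -(mulrA (ksgn S l (i |: J))) mquoX_ksgn eU yXE mquoX_mul; last first.
  move=> x; rewrite !mulmnE !mnm1E.
  have [<-|_] := eqVneq (rshift m i) x; rewrite ?mul0n ?muln0 ?eqxx //.
  by rewrite (negPf (_ : rshift m l != _)) ?muln0 ?eqxx ?orbT // eq_sym (inj_eq (@rshift_inj _ _)).
have := @ksgn_anti S _ i l (i |: J); rewrite setU11 inE lJ orbT => /(_ isT isT il).
rewrite setU1K // eU eD -[ksgn S i (i |: _)]ksgnD1 setU1K //.
have := ksgn_sqr S i J; have := ksgn_sqr S i (J :\ l).
set a := ksgn S i J; set b := ksgn S l J; set c := ksgn S i (J :\ l).
set e := ksgn S l _; set Y := 'X_[_]; set Q := q i _ => hc ha h.
have {}h : b * c = - (a * e).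
  by rewrite -[b]mul1r -ha -(mulrA a a b) h mulrN mulNr -!mulrA hc mulr1.
rewrite (_ : b * Y * (c * Q) = b * c * (Y * Q)); last by ring.
by rewrite h; ring.
Qed.

(** Subtracting d (h v) for one index after another makes the cocycle vanish on all sets missing a
    treated index. In the end only [setT] remains, where the coefficient was 0 from the start and no
    correction changes it. *)
Lemma koszul_exact v : (forall J, koszul_d k v J = 0) -> v setT = 0 ->
  exists u : {set 'I_n} -> T, forall J, v J = koszul_d k u J.
Proof.
move=> hv vT.
suff [u hu uT] : exists2 u : {set 'I_n} -> T,
    forall i (J : {set 'I_n}), i \notin J -> v J - koszul_d k u J = 0 &
    v setT - koszul_d k u setT = 0.
  exists u => J; apply/eqP; rewrite -subr_eq0; apply/eqP.
  have [->//|JT] := eqVneq J setT.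
  have /subsetPn[i _ iJ] : ~~ (setT \subset J) by rewrite subTset.
  exact: hu iJ.
suff [u hu uT] : exists2 u : {set 'I_n} -> T,
    {in enum 'I_n, forall i (J : {set 'I_n}), i \notin J -> v J - koszul_d k u J = 0} &
    v setT - koszul_d k u setT = 0.
  by exists u => // i; apply: hu; rewrite mem_enum.
elim: (enum 'I_n) => [|i r [u hu uT]].
  exists (fun=> 0) => //; rewrite vT sub0r [koszul_d _ _ _]big1 ?oppr0 // => i _.
  exact: scaler0.
pose v' J := v J - koszul_d k u J.
have hv' J : koszul_d k v' J = 0 by rewrite koszul_dB hv koszul_dd subr0.
pose h := koszul_h i v'.
have e J : v J - koszul_d k (fun I => u I + h I) J = v' J - koszul_d k h J.
  rewrite /v' -addrA -opprD; congr (_ - _); rewrite /koszul_d -big_split.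
  by apply: eq_bigr => l _; rewrite scalerDr.
exists (fun I => u I + h I); last first.
  by rewrite e koszul_homotopy_in ?inE // /v' uT raddf0 mulr0 subr0.
move=> l; rewrite inE => lr J lJ; rewrite e.
have [iJ|iJ] := boolP (i \in J); last by rewrite koszul_homotopy_out // subrr.
case/orP: lr => [/eqP el|lr]; first by rewrite el iJ in lJ.
by rewrite koszul_homotopy_in // /v' (hu l) // raddf0 mulr0 subr0.
Qed.
End KoszulExact.

Section CechExact.
Variables (K : fieldType) (m n : nat).
Notation S := {mpoly K[m + n]}.

Lemma free_cech_exact (F : bigraded K m n) p (c : cech F p) : fg_free F -> (p < n)%N ->
  cdiff F p c = 0 -> cobnd F p c.
Proof.
move=> /fg_free_coord[r [b [d [co [_ coL coE _]]]]] pn /cech_cycle[k [v [-> hv hd]]].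
have co0 i : co i 0 = 0.
  by have := coL i 1 0 0; rewrite scaler0 addr0 mul1r -{1}[co i 0]addr0 => /addrI.
have coS i (J : {set 'I_n}) : koszul_d k (fun I => co i (v I) : S^o) J = 0.
  rewrite -(co0 i) -(hd J) (big_morph (co i) (id1 := 0) (op1 := +%R)) //.
    by apply: eq_bigr => l _; have := coL i (ksgn S l J * 'X_(rshift m l) ^+ k) (v (J :\ l)) 0;
      rewrite addr0 co0 addr0 => ->.
  by move=> x z; have := coL i 1 x z; rewrite scale1r mul1r.
have /choice[u hu] : forall i, exists u : {set 'I_n} -> S^o, forall J, co i (v J) = koszul_d k u J.
  (* The coefficient at [setT] is 0 because [v] is supported on p-element sets and p < n. *)
  move=> i; apply: koszul_exact => //; rewrite hv ?co0 // cardsT card_ord.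
  by rewrite neq_ltn pn orbT.
pose U J := \sum_i (u i J : S) *: b i.
have e J : v J = koszul_d k U J.
  rewrite [LHS]coE /koszul_d.
  rewrite (eq_bigr (fun l => \sum_i (ksgn S l J * 'X_(rshift m l) ^+ k * u i (J :\ l)) *: b i)).
    rewrite exchange_big; apply: eq_bigr => i _; rewrite hu scaler_suml.
    by apply: eq_bigr.
  by move=> l _; rewrite scaler_sumr; apply: eq_bigr => i _; rewrite scalerA.
case: p c pn hv => [|p] c pn hv.
  suff : cfrac 0 v k = 0 by [].
  apply/cfrac_eq0 => I /eqP; rewrite cards_eq0 => /eqP ->; exists 0%N.
  by rewrite expr0 scale1r e /koszul_d big_set0.
by exists (cfrac p U k); rewrite cdiff_cfrac; apply: eq_cfrac => I _; rewrite -e.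
Qed.
End CechExact.

(** * Top local cohomology *)

Section LocalCohomology.
Variables (K : fieldType) (m n : nat).
Notation S := {mpoly K[m + n]}.
Notation y i := ('X_(rshift m i) : S).
Notation ymon := (@ymon K m n).

Lemma lcoh_zero_exact (V : bigraded K m n) p (c : cech V p) :
  is_zero (lcoh p V) -> cdiff V p c = 0 -> cobnd V p c.
Proof.
move=> h0 hc.
have hcm : c \in smem (ker_sub (cdiff V p)) by apply/smemP.
have := h0 (qpi _ (SMod hcm)); rewrite -(qpi0 _) => /qpiE.
by rewrite subr0.
Qed.

Section TopClass.
Variable V : bigraded K m n.

Lemma cech_top_cycle (c : cech V n) : c \in smem (ker_sub (cdiff V n)).
Proof. by apply/smemP/cech_large. Qed.

Definition top_class_fun (c : cech V n) : lcoh n V := qpi _ (SMod (cech_top_cycle c)).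

Lemma top_class_linear : linear top_class_fun.
Proof.
move=> a u v; rewrite /top_class_fun.
rewrite (_ : SMod (cech_top_cycle (a *: u + v)) =
  a *: SMod (cech_top_cycle u) + SMod (cech_top_cycle v)); first exact: linearP.
exact: val_inj.
Qed.

Lemma top_class_deg g c : gin g c -> gin g (top_class_fun c).
Proof. by move=> hc; exists (SMod (cech_top_cycle c)). Qed.

Definition top_class : ghom (cech V n) (lcoh n V) := mk_ghom top_class_linear top_class_deg.

Lemma top_class_surj z : exists c, top_class c = z.
Proof.
have [c <-] := qpi_surj z; exists (smod_val c).
by congr qpi; apply: val_inj.
Qed.

Lemma top_class_eq0 c : top_class c = 0 <-> cobnd V n c.
Proof.
split=> [h|h].
  have : top_class_fun c = qpi _ 0 by rewrite qpi0.
  by move=> /qpiE; rewrite subr0.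
rewrite -[RHS](qpi0 _); apply/qpiE; rewrite subr0; exact: h.
Qed.
End TopClass.

Lemma lcoh_map_top_class (V W : bigraded K m n) (f : ghom V W) (c : cech V n) :
  lcoh_map f n (top_class V c) = top_class W (cech_map f n c).
Proof.
refine (etrans (gquo_map_funE _ _ _ _) _).
  by move=> z; apply: cech_map_bnd.
by apply: (congr1 (qpi _)); apply: val_inj.
Qed.

Section Rows.
Lemma uniform_exponent p (Q : {set 'I_n} -> nat -> Prop) :
  (forall I e e', Q I e -> Q I (e' + e)%N) ->
  (forall I : {set 'I_n}, #|I| = p -> exists e, Q I e) ->
  exists e, forall I : {set 'I_n}, #|I| = p -> Q I e.
Proof.
move=> mon h.
have /choice[e he] : forall I : {set 'I_n}, exists e, #|I| = p -> Q I e.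
  move=> I; have [/h[e he]|/eqP ne] := eqVneq #|I| p; first by exists e.
  by exists 0%N.
exists (\sum_I e I)%N => I cI; rewrite (bigD1 I) //= addnC; exact/mon/he.
Qed.

(** Exactness of localization: one power e makes all y_I^e v_I cycles for [g], and their lifts are
    taken over the exponent e + k. *)
Lemma cech_map_exact (U V W : bigraded K m n) (f : ghom U V) (g : ghom V W) p :
  exact_at f g -> exact_at (cech_map f p) (cech_map g p).
Proof.
move=> ex c; split=> [|[u <-]]; last first.
  have [k [v [-> _]]] := cech_frac u; rewrite !cech_map_cfrac -(cfrac0 W p k).
  by apply: eq_cfrac => I _; apply/ex; exists (v I).
have [k [v [-> hv]]] := cech_frac c; rewrite cech_map_cfrac => /cfrac_eq0 h.
have [e he] := uniform_exponent (Q := fun I e => ymon I ^+ e *: g (v I) = 0)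
  (fun I e e' h => etrans (congr1 (fun f => f *: _) (exprD _ e' e))
     (etrans (esym (scalerA _ _ _)) (etrans (congr1 (fun x => _ *: x) h) (scaler0 _ _)))) h.
have /choice[u hu] : forall I : {set 'I_n}, exists x, f x = ymon I ^+ e *: v I.
  move=> I; apply/ex; rewrite ghomZ.
  have [/he//|/hv ->] := eqVneq #|I| p; by rewrite ghom0 scaler0.
exists (cfrac p u (e + k)); rewrite cech_map_cfrac -(cfrac_expand p e v k).
by apply: eq_cfrac => I _.
Qed.

Lemma cech_map_surj (U V M : bigraded K m n) (f : ghom U V) (g : ghom V M) p :
  exact_at f g -> (forall v : M, ytorsion v) ->
  forall c : cech V p.+1, exists b, cech_map f p.+1 b = c.
Proof.
move=> ex tor c; have [h _] := cech_map_exact ex c; apply: h.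
have [k [v [-> hv]]] := cech_frac c; rewrite cech_map_cfrac; apply/cfrac_eq0 => I cI.
have /set0Pn[i iI] : I != set0 by rewrite -card_gt0 cI.
have [e he] := tor (g (v I)) i; exists e.
by rewrite /Defs.ymon (big_setD1 i) //= exprMn mulrC -scalerA he scaler0.
Qed.
End Rows.

Section Degree0.
Variable V : bigraded K m n.
(** The only set with 0 elements is empty and y_(set0) = 1, so this identifies V with its Cech
    module in degree 0. *)
Definition cech0_fun (v : V) : cech V 0 := cfrac 0 (fun=> v) 0.
Lemma cech0_linear : linear cech0_fun.
Proof. by move=> a u v; rewrite -cfracZD. Qed.
Lemma cech0_deg g v : gin g v -> gin g (cech0_fun v).
Proof.
move=> hv I; rewrite cfracE; exists v, 0%N; split=> //.
by rewrite mulr0n addr0.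
Qed.
Definition cech0 : ghom V (cech V 0) := mk_ghom cech0_linear cech0_deg.

Lemma cech0_surj c : exists v, cech0 v = c.
Proof. by have [v ->] := cech0_const c; exists v. Qed.

Lemma cech0_inj v : cech0 v = 0 -> v = 0.
Proof.
move=> /(cfrac_eq0 0 (fun=> v))/(_ set0); rewrite cards0 => /(_ erefl)[e].
by rewrite ymon0 expr1n scale1r.
Qed.
End Degree0.
End LocalCohomology.

(** * The complex of top local cohomologies and its homology *)

Section TopCohomologyComplex.
Variables (K : fieldType) (m n : nat) (M : bigraded K m n).
Variables (F : nat -> bigraded K m n) (phi : forall i, ghom (F i.+1) (F i)).
Variable (eps : ghom (F 0) M).
Hypothesis F_free : forall i, fg_free (F i).
Hypothesis eps_surj : forall x, exists v, eps v = x.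
Hypothesis eps_exact : exact_at (phi 0) eps.
Hypothesis phi_exact : forall i, exact_at (phi i.+1) (phi i).
Hypothesis M_torsion : forall v : M, ytorsion v.

Notation X := (fun i p => cech (F i) p).
Notation dX := (fun i p => cdiff (F i) p).
Notation fX := (fun i p => cech_map (phi i) p).
Notation psi i := (lcoh_map (phi i) n).

Lemma bnd_cobnd i p (c : cech (F i) p) : bnd dX (c : X i p) <-> cobnd (F i) p c.
Proof. by case: p c. Qed.

Let fd i p (x : X i.+1 p) : fX i p.+1 (dX i.+1 p x) = dX i p (fX i p x).
Proof. exact/esym/cech_map_diff. Qed.
Let dd i p (x : X i p) : dX i p.+1 (dX i p x) = 0.
Proof. exact: cdiff_cdiff. Qed.
Let col_exact i p (x : X i p) : (p < n)%N -> dX i p x = 0 -> bnd dX x.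
Proof. by move=> pn h; apply/bnd_cobnd/free_cech_exact. Qed.
Let row_exact i p : exact_at (fX i.+1 p) (fX i p).
Proof. exact: cech_map_exact. Qed.
Let row_surj p (x : X 0 p.+1) : exists y, fX 0 p.+1 y = x.
Proof. exact: cech_map_surj eps_exact M_torsion x. Qed.
Let e0_exact : exact_at (fX 0 0) (cech_map eps 0).
Proof. exact: cech_map_exact. Qed.
Let e0_surj x : exists c, cech_map eps 0 c = x.
Proof.
have [v <-] := cech0_surj x; have [a <-] := eps_surj v.
by exists (cech0 _ a); apply: cech_map_cfrac.
Qed.

Definition top_cycle i (z : lcoh n (F i)) : Prop :=
  match i return lcoh n (F i) -> Prop with 0 => fun _ => True | k.+1 => fun z => psi k z = 0 end z.

Lemma top_class_bnd i (c : cech (F i) n) : top_class (F i) c = 0 <-> bnd dX (c : X i n).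
Proof. by split=> [/top_class_eq0/bnd_cobnd|/bnd_cobnd/top_class_eq0]. Qed.

Lemma top_cycleP i (c : cech (F i) n) : top_cycle (top_class (F i) c) <-> mod_cycle dX fX (c : X i n).
Proof. by case: i c => [//|i] c; rewrite /top_cycle lcoh_map_top_class; apply: top_class_bnd. Qed.

Lemma psi_psi i z : psi i (psi i.+1 z) = 0.
Proof.
have [c <-] := top_class_surj z; rewrite !lcoh_map_top_class.
have [_ h] := @row_exact i n (fX i.+1 n c).
by rewrite h ?ghom0 //; exists c.
Qed.

Lemma top_exact i (z : lcoh n (F i)) : i != n -> top_cycle z -> exists u, psi i u = z.
Proof.
move=> ine; have [c <-] := top_class_surj z => /top_cycleP hc.
have [y hy] := off_diagonal_exact fd dd col_exact row_exact row_surj (leqnn n) ine hc.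
exists (top_class _ y); rewrite lcoh_map_top_class; apply/eqP.
by rewrite eq_sym -subr_eq0 -ghomB; apply/eqP/top_class_bnd.
Qed.

(* The zigzag correspondence between H^n_Q(F_n) and M. *)
Definition zigzag (z : lcoh n (F n)) (x : M) : Prop := exists2 c : cech (F n) n,
  top_class (F n) c = z & @diag_rel _ _ _ _ X _ dX fX (cech_map eps 0) n c (cech0 M x).

Lemma zigzagP a z z' x x' : zigzag z x -> zigzag z' x' -> zigzag (a *: z + z') (a *: x + x').
Proof.
move=> [c <- hc] [c' <- hc']; exists (a *: c + c'); first by rewrite linearP.
by rewrite linearP; apply: diag_relP.
Qed.

Lemma zigzagD z z' x x' : zigzag z x -> zigzag z' x' -> zigzag (z + z') (x + x').
Proof. by rewrite -{2}[z]scale1r -{2}[x]scale1r; apply: zigzagP. Qed.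

Lemma zigzag0 : zigzag 0 0.
Proof. by exists 0; rewrite ghom0 //; apply: diag_rel0. Qed.

Lemma zigzag_im u x : zigzag (psi n u) x -> x = 0.
Proof.
move=> [c]; have [b <-] := top_class_surj u; rewrite lcoh_map_top_class => hc rc.
apply: cech0_inj; apply: (diag_rel_fun fd col_exact row_exact e0_exact (leqnn n) _ rc (y := b)).
by apply/top_class_bnd; rewrite ghomB hc subrr.
Qed.

Lemma zigzag_ker z : zigzag z 0 -> exists u, psi n u = z.
Proof.
move=> [c <-]; rewrite ghom0 => rc.
have [y hy] := diag_rel_inj fd dd row_exact e0_exact (leqnn n) rc.
exists (top_class _ y); rewrite lcoh_map_top_class; apply/eqP.
by rewrite eq_sym -subr_eq0 -ghomB; apply/eqP/top_class_bnd.
Qed.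

(** By linearity x - x' is a partner of 0, and 0 is an image under psi. *)
Lemma zigzag_uniq z x x' : zigzag z x -> zigzag z x' -> x = x'.
Proof.
move=> h h'; apply/eqP; rewrite -subr_eq0; apply/eqP/(@zigzag_im 0).
rewrite ghom0 -[0](subrr z) -[z - z]addrC -[x - x']addrC -!scaleN1r.
exact: zigzagP.
Qed.

Lemma zigzag_total g z : top_cycle z -> gin g z -> exists2 x, gin g x & zigzag z x.
Proof.
move=> tz gz; have [c hc] := top_class_surj z.
have [|c' gc' e] := @homog_lift _ _ _ _ _ _ (top_class (F n)) g c; first by rewrite hc.
have [|x gx rx] := diag_rel_total_homog (cech_map eps 0) fd col_exact row_exact (leqnn n) gc'.
  by apply/top_cycleP; rewrite e hc.
have [v hv] := cech0_surj x.
have [|v' gv' e'] := @homog_lift _ _ _ _ _ _ (cech0 M) g v; first by rewrite hv.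
by exists v' => //; exists c'; rewrite ?e ?e' ?hc // hv.
Qed.

Lemma zigzag_surj x : exists2 z, top_cycle z & zigzag z x.
Proof.
have [c rc] := diag_rel_surj fd dd row_exact row_surj e0_surj n (cech0 M x).
exists (top_class _ c); last by exists c.
by apply/top_cycleP/diag_rel_mod_cycle; exact: rc.
Qed.

Lemma top_cycle_hcomp i g (z : lcoh n (F i)) : top_cycle z -> top_cycle (hcomp g z).
Proof. by case: i z => [//|i] z h; rewrite /top_cycle -hcomp_ghom [psi i z]h hcomp0. Qed.

(** Supplies the degree that [zigzag_surj] does not control. The components of z have homogeneous
    partners; these add up to a partner of z, which is x by uniqueness, so they are the components
    of x. *)
Lemma zigzag_hcomp g z x : top_cycle z -> zigzag z x -> zigzag (hcomp g z) (hcomp g x).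
Proof.
move=> tz zx; have [_ [s [us s0 es]]] := hcompP z.
have /choice[xc hxc] : forall g, exists x, gin g x /\ zigzag (hcomp g z) x.
  by move=> g'; have [x' gx' rx'] := zigzag_total (top_cycle_hcomp g' tz) (gin_hcomp g' z); exists x'.
rewrite (hcomp_unique (c := fun g => if g \in s then xc g else 0)).
  by case: ifP => [_|/negbT/s0 ->]; [case: (hxc g)|exact: zigzag0].
split=> [g'|]; first by case: ifP => _; [case: (hxc g')|exact: gin0].
exists s; split=> // [g' /negPf -> //|].
rewrite (eq_big_seq xc) => [|g' ->//]; apply: (zigzag_uniq zx); rewrite es.
elim: (s) => [|g' r IH]; first by rewrite !big_nil; apply: zigzag0.
rewrite !big_cons; apply: zigzagD => //.
by case: (hxc g').
Qed.

End TopCohomologyComplex.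

(** * Graded free modules *)

Section HomogeneousBases.
Variables (K : fieldType) (p : nat) (G : zmodType) (w : 'I_p -> G).
Notation A := {mpoly K[p]}.
Notation gmod := (gmod K w).

Definition spanned (V : gmod) (T : finType) (D : pred T) (b : T -> V) (v : V) : Prop :=
  exists c : T -> A, v = \sum_(t | D t) c t *: b t.

(** The basis is indexed by a subset [D] of a fixed finite type, so that elimination can delete an
    index without renumbering. *)
Definition hfree (V : gmod) (T : finType) (D : pred T) (b : T -> V) (d : T -> G) : Prop :=
  (forall t, D t -> gin (d t) (b t)) /\
  forall c : T -> A, \sum_(t | D t) c t *: b t = 0 -> forall t, D t -> c t = 0.

Lemma hfree_eq (V : gmod) (T : finType) (D : pred T) (b : T -> V) d (c c' : T -> A) :
  hfree D b d -> \sum_(t | D t) c t *: b t = \sum_(t | D t) c' t *: b t ->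
  forall t, D t -> c t = c' t.
Proof.
move=> [_ hf] e t Dt; apply/eqP; rewrite -subr_eq0; apply/eqP.
apply: (hf (fun t => c t - c' t)) => //.
rewrite (eq_bigr (fun t => c t *: b t - c' t *: b t)) => [|s _]; last by rewrite scalerBl.
by rewrite sumrB e subrr.
Qed.

(** Dropping all terms of the wrong weight from the coordinates leaves a homogeneous element
    unchanged; by uniqueness of coordinates there were none. *)
Lemma hfree_coord_homog (V : gmod) (T : finType) (D : pred T) (b : T -> V) d (c : T -> A) g :
  hfree D b d -> gin g (\sum_(t | D t) c t *: b t) ->
  forall t, D t -> whomog w (g - d t) (c t).
Proof.
move=> hf hg t Dt mm.
pose c' t := \sum_(k <- msupp (c t) | mnm_wt w k + d t == g) (c t)@_k *: 'X_[k].
have e : \sum_(t | D t) c t *: b t = \sum_(t | D t) c' t *: b t.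
  rewrite -[LHS](hcomp_id hg) hcomp_sum; apply: eq_bigr => s Ds.
  rewrite {1}[c s]mpolyE !scaler_suml hcomp_sum [RHS]big_mkcond; apply: eq_bigr => k _.
  rewrite (hcomp_homog g (g := mnm_wt w k + d s)) 1?eq_sym //.
  apply: ginZ; last exact: hf.1.
  by move=> k' /msuppZ_le; rewrite msuppX inE => /eqP ->.
rewrite (hfree_eq hf e Dt) mcoeff_msupp /c' raddf_sum /=.
have [<-|ne] := eqVneq (mnm_wt w mm + d t) g; first by rewrite addrK.
rewrite big1 ?eqxx // => k hk; rewrite mcoeffZ mcoeffX.
by case: (k =P mm) hk => [->|]; rewrite ?mulr0 // (negPf ne).
Qed.

Lemma hfree_fg_free (V : gmod) (T : finType) (D : pred T) (b : T -> V) d :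
  hfree D b d -> (forall v, spanned D b v) -> fg_free V.
Proof.
move=> hf sp; exists #|D|, (fun i => b (enum_val i)), (fun i => d (enum_val i)).
split=> [i|v]; first exact/hf.1/(enum_valP i).
have [c hc] := sp v.
pose C (c0 : 'I_#|D| -> A) t := if [pick i | @enum_val _ D i == t] is Some i then c0 i else 0.
have CE c0 i : C c0 (enum_val i) = c0 i.
  rewrite /C; case: pickP => [l /eqP/enum_val_inj -> //|/(_ i)]; by rewrite eqxx.
have e (c0 : 'I_#|D| -> A) :
    \sum_i c0 i *: b (enum_val i) = \sum_(t | D t) C c0 t *: b t.
  by rewrite (big_enum_val (fun t => C c0 t *: b t)); apply: eq_bigr => i _; rewrite CE.
exists [ffun i => c (enum_val i)]; split=> [|c' hc'].
  rewrite hc (big_enum_val (fun t => c t *: b t)); apply: eq_bigr => i _.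
  by rewrite ffunE.
apply/ffunP => i; rewrite ffunE -[c' i]CE; apply: hfree_eq hf _ _ (enum_valP i).
by rewrite -e -hc' hc.
Qed.

Lemma fg_free_hfree (V : gmod) : fg_free V -> exists (r : nat) (b : 'I_r -> V) d,
  hfree xpredT b d /\ forall v, spanned xpredT b v.
Proof.
move=> [r [b [d [hd hb]]]]; exists r, b, d; split; first split=> // c hc i _.
  have [c0 [_ u]] := hb 0.
  have := u [ffun i => c i]; rewrite (u [ffun=> 0]); last first.
    by rewrite big1 // => l _; rewrite ffunE scale0r.
  move=> /(_ _)/ffunP/(_ i); rewrite !ffunE => <- //.
  by rewrite -[LHS]hc; apply: eq_bigr => l _; rewrite ffunE.
by move=> v; have [c [-> _]] := hb v; exists c.
Qed.

Lemma spannedZD (V : gmod) (T : finType) (D : pred T) (b : T -> V) a u v :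
  spanned D b u -> spanned D b v -> spanned D b (a *: u + v).
Proof.
move=> [c ->] [c' ->]; exists (fun t => a * c t + c' t).
rewrite scaler_sumr -big_split; apply: eq_bigr => t _.
by rewrite scalerDl scalerA.
Qed.

Lemma spanned_sum (V : gmod) (T : finType) (D : pred T) (b : T -> V)
    (I : Type) (r : seq I) (P : pred I) (F : I -> V) :
  (forall i, P i -> spanned D b (F i)) -> spanned D b (\sum_(i <- r | P i) F i).
Proof.
move=> h; apply: big_ind => // [|x y hx hy].
  by exists (fun=> 0); rewrite big1 // => t _; rewrite scale0r.
by rewrite -[x]scale1r; apply: spannedZD.
Qed.

Lemma spannedZ (V : gmod) (T : finType) (D : pred T) (b : T -> V) a v :
  spanned D b v -> spanned D b (a *: v).
Proof.
move=> [c ->]; exists (fun t => a * c t); rewrite scaler_sumr; apply: eq_bigr => t _.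
by rewrite scalerA.
Qed.

Lemma spanned_mem (V : gmod) (T : finType) (D : pred T) (b : T -> V) t :
  D t -> spanned D b (b t).
Proof.
move=> Dt; exists (fun s => if s == t then 1 else 0).
rewrite (bigD1 t) //= eqxx scale1r big1 ?addr0 // => s /andP[_ /negPf ->].
by rewrite scale0r.
Qed.

Hypothesis wt_pos : forall k : 'X_{1..p}, mnm_wt w k = 0 -> k = 0%MM.

(* Gaussian elimination: since weights are positive, an entry of the matrix of
   f with nonzero constant coefficient is a constant, hence a pivot. *)
Lemma kernel_hfree (V W : gmod) (f : ghom V W) (T J : finType) (E : pred J) (u : J -> W) e
    (D : pred T) (b : T -> V) d :
  hfree D b d -> hfree E u e ->
  (forall t, D t -> spanned E u (f (b t))) ->
  (forall j, E j -> exists2 v, spanned D b v & f v = u j) ->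
  exists (D' : pred T) b' d', hfree D' b' d' /\
    forall v, spanned D' b' v <-> spanned D b v /\ f v = 0.
Proof.
have [k] := ubnP #|E|; elim: k => // k IH in E D b d *; rewrite ltnS => cE hb hu hfb hsurj.
have [E0|/existsP[j0 /negbNE Ej0]] := boolP [forall j, ~~ E j]; last first; last first.
  exists D, b, d; split=> // v; split=> [hv|[]//]; split=> //.
  have [c ->] := hv; rewrite ghom_sum big1 // => t Dt; rewrite ghomZ.
  have [c' ->] := hfb t Dt; rewrite big_pred0 ?scaler0 // => j.
  by apply: negPf; apply: (forallP E0).
have /choice[a ha] : forall t, exists a : J -> A, D t -> f (b t) = \sum_(j | E j) a j *: u j.
  move=> t; have [Dt|nDt] := boolP (D t); last by exists (fun=> 0).
  by have [c hc] := hfb t Dt; exists c.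
have fE c : f (\sum_(t | D t) c t *: b t) = \sum_(j | E j) (\sum_(t | D t) c t * a t j) *: u j.
  rewrite ghom_sum (eq_bigr (fun t => \sum_(j | E j) (c t * a t j) *: u j)).
    by rewrite exchange_big; apply: eq_bigr => j _; rewrite scaler_suml.
  by move=> t Dt; rewrite ghomZ (ha t Dt) scaler_sumr; apply: eq_bigr => j _; rewrite scalerA.
(* If every entry in column j0 had constant term 0, then so would the coefficient 1 of [u j0], which
   is in the image. *)
have [t0 Dt0 at0] : exists2 t0, D t0 & (a t0 j0)@_0%MM != 0.
  apply: contrapT => hn; have [v [c ->]] := hsurj _ Ej0; rewrite fE.
  rewrite [RHS](_ : _ = \sum_(j | E j) (if j == j0 then 1 else 0) *: u j); last first.
    rewrite (bigD1 j0) //= eqxx scale1r big1 ?addr0 // => j /andP[_ /negPf ->].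
    exact: scale0r.
  move=> /(hfree_eq hu)/(_ _ Ej0); rewrite eqxx => /(congr1 (mcoeff 0%MM)).
  rewrite mcoeff1 eqxx raddf_sum big1 => [/eqP|t Dt] /=; first by rewrite eq_sym oner_eq0.
  rewrite rmorphM /=; have [->|ne] := eqVneq (a t j0)@_0%MM 0; first by rewrite mulr0.
  by case: hn; exists t.
have aw t : D t -> whomog w (d t - e j0) (a t j0).
  move=> Dt; apply: (hfree_coord_homog hu) => //.
  by rewrite -ha //; apply/ghomP/hb.1.
(* A homogeneous entry with nonzero constant term has degree 0; by [wt_pos] it has no other
   monomial, so the pivot is the scalar [kap]. *)
have de : d t0 = e j0.
  apply/eqP; rewrite -subr_eq0; apply/eqP.
  rewrite -(aw t0 Dt0 0%MM) ?mcoeff_msupp //.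
  by apply: big1 => i _; rewrite mnm0E mulr0n.
pose kap := (a t0 j0)@_0%MM.
have aC : a t0 j0 = kap%:MP.
  apply/mpolyP => mm; rewrite mcoeffC; have [->|ne] := eqVneq mm 0%MM; first by rewrite mulr1.
  rewrite mulr0; apply/eqP; rewrite mcoeff_eq0; apply: contra ne => hm.
  by apply/eqP/wt_pos; rewrite (aw _ Dt0 _ hm) de subrr.
pose D1 := [pred t | D t && (t != t0)].
(* Row reduction: f (b1 t) has no [u j0] coordinate, and [b1 t0] is 0. In the new basis [q c] is the
   coefficient of [b t0]. *)
pose b1 t := b t - (a t j0 * (kap^-1)%:MP) *: b t0.
pose q (c : T -> A) := \sum_(t | D t) c t * (a t j0 * (kap^-1)%:MP).
have kap_unit : a t0 j0 * (kap^-1)%:MP = 1 by rewrite aC -mpolyCM mulfV // mpolyC1.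
have b1t0 : b1 t0 = 0 by rewrite /b1 kap_unit scale1r subrr.
have decE c : \sum_(t | D t) c t *: b t = \sum_(t | D1 t) c t *: b1 t + q c *: b t0.
  have -> : \sum_(t | D1 t) c t *: b1 t = \sum_(t | D t) c t *: b1 t.
    by rewrite [RHS](bigD1 t0) //= b1t0 scaler0 add0r.
  rewrite [X in _ = X + _](eq_bigr (fun t => c t *: b t - (c t * (a t j0 * (kap^-1)%:MP)) *: b t0)).
    by rewrite sumrB -scaler_suml -/(q c) subrK.
  by move=> t _; rewrite /b1 scalerBr scalerA.
(* Kernel elements and preimages of the remaining [u j] do not involve [b t0], so [t0] and [j0] can
   be removed together. *)
have q0 c g : g j0 = 0 -> f (\sum_(t | D t) c t *: b t) = \sum_(j | E j) g j *: u j -> q c = 0.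
  move=> gj0; rewrite fE => /(hfree_eq hu)/(_ _ Ej0); rewrite gj0 => h.
  rewrite /q (eq_bigr (fun t => c t * a t j0 * (kap^-1)%:MP)) => [|t _]; last by rewrite mulrA.
  by rewrite -mulr_suml h mul0r.
pose E1 := [pred j | E j && (j != j0)].
have b1_span t : D t -> spanned D b (b1 t).
  by move=> Dt; rewrite /b1 addrC -scaleNr; apply: spannedZD; apply: spanned_mem.
have [|||||D' [b' [d' [hb' sp']]]] := IH E1 D1 b1 d.
- apply: leq_trans cE.
  by rewrite [X in (_ < X)%N](cardD1 j0) [j0 \in _]Ej0 add1n ltnS;
    apply/subset_leq_card/subsetP => j; rewrite !inE andbC.
- split=> [t /andP[Dt _]|c hc t /andP[Dt tt0]].
    apply: ginB; first exact: hb.1.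
    rewrite -(subrK (e j0) (d t)); apply: ginZ; last by rewrite -de; apply: hb.1.
    rewrite -[_ - _]addr0; apply: whomogM; first exact: aw.
    move=> mm; rewrite msuppC; case: ifP => // _; rewrite inE => /eqP ->.
    by apply: big1 => i _; rewrite mnm0E mulr0n.
  pose c' s := if s == t0 then 0 else c s.
  pose c'' s := if s == t0 then - q c' else c s.
  suff /hb.2/(_ _ Dt) : \sum_(s | D s) c'' s *: b s = 0 by rewrite /c'' (negPf tt0).
  have c''0 : c'' t0 = - q c' by rewrite /c'' eqxx.
  have c'0 : c' t0 = 0 by rewrite /c' eqxx.
  rewrite (bigD1 t0) //= c''0.
  have e1 : \sum_(s | D s && (s != t0)) c'' s *: b s = \sum_(s | D s) c' s *: b s.
    rewrite [RHS](bigD1 t0) //= c'0 scale0r add0r; apply: eq_bigr => s /andP[_ /negPf h].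
    by rewrite /c'' /c' h.
  rewrite e1 decE scaleNr addrCA addNr addr0 -[RHS]hc.
  by apply: eq_bigr => s /andP[_ /negPf h]; rewrite /c' h.
- split=> [j /andP[Ej _]|c hc j /andP[Ej jj0]]; first exact: hu.1.
  pose c' s := if s == j0 then 0 else c s.
  suff /hu.2/(_ _ Ej) : \sum_(s | E s) c' s *: u s = 0 by rewrite /c' (negPf jj0).
  have c'0 : c' j0 = 0 by rewrite /c' eqxx.
  rewrite (bigD1 j0) //= c'0 scale0r add0r -[RHS]hc.
  by apply: eq_bigr => s /andP[_ /negPf h]; rewrite /c' h.
- move=> t /andP[Dt _].
  exists (fun j => a t j - a t j0 * (kap^-1)%:MP * a t0 j).
  rewrite /b1 ghomB ghomZ !ha // scaler_sumr -sumrB (bigD1 j0) //= scalerA -scalerBl.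
  rewrite {1}aC -mulrA -mpolyCM mulVf // mpolyC1 mulr1 subrr scale0r add0r.
  by apply: eq_bigr => j _; rewrite scalerA scalerBl.
- move=> j /andP[Ej jj0]; have [v [c ->] hv] := hsurj j Ej.
  exists (\sum_(t | D1 t) c t *: b1 t); first by exists c.
  rewrite -hv decE (q0 c (fun l => if l == j then 1 else 0)) ?scale0r ?addr0 //.
    by rewrite eq_sym (negPf jj0).
  rewrite hv (bigD1 j) //= eqxx scale1r big1 ?addr0 // => l /andP[_ /negPf ->].
  exact: scale0r.
exists D', b', d'; split=> // v; split=> [/sp'[[c ->] h]|[[c hv] h]].
  split=> //; apply: spanned_sum => t /andP[Dt _]; exact/spannedZ/b1_span.
apply/sp'; split=> //; exists c; rewrite hv decE (q0 c (fun=> 0)) ?scale0r ?addr0 //.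
by rewrite -hv h big1 // => l _; rewrite scale0r.
Qed.
End HomogeneousBases.

(** * Top local cohomology of free modules *)

Section MixedMonomials.
Variables (K : fieldType) (m n : nat).
Notation S := {mpoly K[m + n]}.
Notation y i := ('X_(rshift m i) : S).
Notation ymon := (@ymon K m n).
Notation x_incl := (@x_incl K m n).

Definition ypow (delta : {ffun 'I_n -> nat}) : S := \prod_i y i ^+ delta i.

Definition xpart (mm : 'X_{1..m + n}) : 'X_{1..m} := [multinom mm (lshift n i) | i < m].
Definition ypart (mm : 'X_{1..m + n}) : {ffun 'I_n -> nat} := [ffun i => mm (rshift m i)].
Definition mjoin (g : 'X_{1..m}) (delta : {ffun 'I_n -> nat}) : 'X_{1..m + n} :=
  [multinom match split i with inl a => g a | inr b => delta b end | i < m + n].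

Lemma mjoin_l g delta i : mjoin g delta (lshift n i) = g i.
Proof. by rewrite mnmE (unsplitK (inl i)). Qed.

Lemma mjoin_r g delta i : mjoin g delta (rshift m i) = delta i.
Proof. by rewrite mnmE (unsplitK (inr i)). Qed.

Lemma mjoin_eq g delta g' delta' :
  (mjoin g delta == mjoin g' delta') = (g == g') && (delta == delta').
Proof.
apply/eqP/andP => [e|[/eqP -> /eqP ->] //]; split; apply/eqP.
  by apply/mnmP => i; rewrite -(mjoin_l g delta) e mjoin_l.
by apply/ffunP => i; rewrite -(mjoin_r g) e mjoin_r.
Qed.

Lemma x_inclX g : x_incl 'X_[g] = \prod_(i < m) 'X_(lshift n i) ^+ g i.
Proof. by rewrite /= comp_mpolyX; apply: eq_bigr => i _; rewrite tnth_mktuple. Qed.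

Lemma mpolyX_parts mm : 'X_[mm] = x_incl 'X_[xpart mm] * ypow (ypart mm).
Proof.
rewrite mpolyXE_id big_split_ord x_inclX; congr (_ * _); apply: eq_bigr => i _.
  by rewrite mnmE.
by rewrite ffunE.
Qed.

Lemma mpolyX_join g delta : 'X_[mjoin g delta] = x_incl 'X_[g] * ypow delta.
Proof.
rewrite mpolyX_parts; congr (x_incl 'X_[_] * ypow _).
  by apply/mnmP => i; rewrite mnmE mjoin_l.
by apply/ffunP => i; rewrite ffunE mjoin_r.
Qed.

(** S is free over K[x] on the y-monomials; this reads off the coefficients. *)
Lemma mcoeff_x_incl_ypow (f : {mpoly K[m]}) delta g delta' :
  (x_incl f * ypow delta)@_(mjoin g delta') = if delta == delta' then f@_g else 0.
Proof.
have -> : x_incl f * ypow delta = \sum_(k <- msupp f) f@_k *: 'X_[mjoin k delta].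
  rewrite {1}[f]mpolyE raddf_sum mulr_suml; apply: eq_bigr => k _.
  by rewrite /= comp_mpolyZ mpolyX_join -scalerAl.
rewrite raddf_sum /= (eq_bigr (fun k => f@_k * ((k == g) && (delta == delta'))%:R)); last first.
  by move=> k _; rewrite mcoeffZ mcoeffX mjoin_eq.
case: (delta == delta'); last by rewrite big1 // => k _; rewrite andbF mulr0.
have [gf|gf] := boolP (g \in msupp f).
  rewrite (bigD1_seq g) //= eqxx mulr1 big1 ?addr0 // => k /negPf ->; exact: mulr0.
rewrite (memN_msupp_eq0 gf) big1_seq // => k /andP[_ kf].
by case: eqP => [e|_]; rewrite ?mulr0 // -e kf in gf *.
Qed.

Lemma ypowD (d d' : {ffun 'I_n -> nat}) : ypow [ffun i => d i + d' i]%N = ypow d * ypow d'.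
Proof. by rewrite /ypow -big_split; apply: eq_bigr => i _; rewrite ffunE exprD. Qed.

Lemma ymonX e : ymon setT ^+ e = ypow [ffun=> e].
Proof.
by rewrite /Defs.ymon -prodrXl /ypow; apply: eq_big => i; rewrite ?inE // ffunE.
Qed.

Lemma ymon_deg_setT : ymon_deg m [set: 'I_n] = (0, n%:Z).
Proof.
rewrite /ymon_deg (eq_bigr (fun=> (0, 1))) => [|i _]; last exact: bideg_y.
rewrite (eq_bigl xpredT) => [|i]; last by rewrite inE.
rewrite big_const cardT size_enum_ord; elim: n => // k /= ->.
by congr pair; rewrite ?addr0 // intS.
Qed.

Lemma ypow_whomog (delta : {ffun 'I_n -> nat}) : whomog (@bideg m n) (0, (\sum_i delta i)%N%:Z) (ypow delta).
Proof.
have -> : (0, (\sum_i delta i)%N%:Z) = \sum_i (0 : int, 1 : int) *+ delta i.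
  elim/big_rec2: _ => // i a b _ <-.
  rewrite PoszD; elim: (delta i) => [|k IH]; first by rewrite mulr0n !add0r.
  by rewrite mulrS -addrA -IH; congr pair; rewrite ?addr0 // intS addrA.
by apply: whomog_prod => i _; rewrite -(@bideg_y m n i); apply/whomogX/whomogU.
Qed.

Lemma mnm_wt_snd mm : (mnm_wt (@bideg m n) mm).2 = (\sum_i ypart mm i)%N%:Z.
Proof.
have sndD (a b : int * int) : (a + b).2 = a.2 + b.2 by [].
have sndM (a : int * int) k : (a *+ k).2 = a.2 *+ k.
  by elim: k => // k IH; rewrite !mulrS sndD IH.
rewrite /mnm_wt (big_morph _ sndD (erefl (0 : int * int).2)) big_split_ord /=.
rewrite big1 ?add0r => [|i _].
  elim/big_rec2: _ => // i a b _ ->.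
  by rewrite sndM bideg_y ffunE natz PoszD.
rewrite sndM /bideg; case: splitP => [k _|k /= e]; first by rewrite mul0rn.
by have := ltn_ord i; rewrite e -ltn_subRL subnn.
Qed.
End MixedMonomials.

Section TopFractions.
Variables (K : fieldType) (m n : nat) (V : bigraded K m n).
Notation S := {mpoly K[m + n]}.
Notation y i := ('X_(rshift m i) : S).
Notation ymon := (@ymon K m n).

Definition top_frac (v : V) (k : nat) : lcoh n V := top_class V (cfrac n (fun=> v) k).

Lemma top_fracZD a u v k : top_frac (a *: u + v) k = a *: top_frac u k + top_frac v k.
Proof. by rewrite /top_frac cfracZD linearP. Qed.

Lemma top_frac_sum (J : Type) (r : seq J) (P : pred J) (a : J -> S) (v : J -> V) k :
  top_frac (\sum_(i <- r | P i) a i *: v i) k = \sum_(i <- r | P i) a i *: top_frac (v i) k.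
Proof.
by rewrite /top_frac cfrac_sum ghom_sum; apply: eq_bigr => i _; rewrite ghomZ.
Qed.

Lemma card_full (I : {set 'I_n}) : #|I| = n -> I = setT.
Proof. by move=> cI; apply/eqP; rewrite eqEcard subsetT cI cardsT card_ord leqnn. Qed.

Lemma top_frac_expand e v k : top_frac (ymon setT ^+ e *: v) (e + k) = top_frac v k.
Proof.
rewrite /top_frac -(cfrac_expand n e (fun=> v) k); congr (top_class V _).
by apply: eq_cfrac => I /card_full ->.
Qed.

(** The class depends only on the integer exponents d i - k; sums avoid truncated subtraction. *)
Lemma top_frac_ypow_shift (d d' : {ffun 'I_n -> nat}) v k l :
  (forall i, (d' i + k = l + d i)%N) ->
  top_frac (ypow K m d' *: v) l = top_frac (ypow K m d *: v) k.
Proof.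
move=> h; rewrite -(top_frac_expand k) -[RHS](top_frac_expand l) !scalerA !ymonX -!ypowD.
rewrite [(k + l)%N]addnC; congr (top_frac (_ *: _) _); congr (ypow K m _); apply/ffunP => i.
by rewrite !ffunE addnC h.
Qed.

Lemma gin_top_frac g z : gin g z -> exists v k, gin (g + (0, n%:Z) *+ k) v /\ z = top_frac v k.
Proof.
have [c <-] := top_class_surj z => hz.
have [c' gc' <-] := homog_lift hz.
have cT : #|[set: 'I_n]| == n by rewrite cardsT card_ord.
have [v [k [gv e]]] := gc' (exist _ setT cT).
exists v, k; split; first by rewrite -(ymon_deg_setT m n).
congr (top_class V _); apply: prod_eq => I.
have -> : I = exist _ setT cT by apply/val_inj/card_full/eqP/(valP I).
by rewrite cfracE e.
Qed.

Lemma top_frac_gin g v k : gin (g + (0, n%:Z) *+ k) v -> gin g (top_frac v k).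
Proof.
move=> gv; apply: (ghomP (top_class V)) => I; rewrite cfracE; exists v, k; split=> //.
by rewrite (card_full (eqP (valP I))) ymon_deg_setT.
Qed.

(** The factor y_i cancels from the denominator, so the fraction comes from the localization at the
    product of the other variables y_l. *)
Lemma top_frac_yk i v k : top_frac (y i ^+ k *: v) k = 0.
Proof.
apply/top_class_eq0.
suff H p : p = n -> cobnd V p (cfrac p (fun=> y i ^+ k *: v) k) by apply: H.
case: p => [n0|p pn]; first by suff : (i < 0)%N by []; apply: leq_trans (ltn_ord i) _; rewrite -n0.
exists (cfrac p (fun I => if I == [set~ i] then ksgn S i setT *: v else 0) k).
rewrite cdiff_cfrac; apply: eq_cfrac => I; rewrite pn => /card_full ->.
rewrite /koszul_d (bigD1 i) ?inE //= setTD eqxx big1 ?addr0 => [|l /andP[_ li]].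
  by rewrite scalerA mulrAC ksgn_sqr mul1r.
by rewrite setTD (inj_eq (can_inj (@setCK _))) (inj_eq set1_inj) (negPf li) scaler0.
Qed.

(** One half of the description of H^n_Q(V) as the direct limit of V / (y_1^k, ..., y_n^k) V under
    multiplication by y_1 ... y_n. *)
Lemma top_frac_eq0 v k : top_frac v k = 0 -> exists e (u : 'I_n -> V),
  ymon setT ^+ e *: v = \sum_i y i ^+ (e + k) *: u i.
Proof.
move=> /top_class_eq0 h.
suff H p (w : {set 'I_n} -> V) : cobnd V p (cfrac p w k) -> forall I : {set 'I_n}, #|I| = p ->
    exists e (u : 'I_n -> V), ymon I ^+ e *: w I = \sum_(i in I) y i ^+ (e + k) *: u i.
  have [|e [u hu]] := H n (fun=> v) h setT; first by rewrite cardsT card_ord.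
  by exists e, u; rewrite hu; apply: eq_bigl => i; rewrite inE.
case: p => [/cfrac_eq0 h0 I /[dup] /h0[e he] /eqP|p [b hb] I cI].
  by rewrite cards_eq0 => /eqP I0; exists e, (fun=> 0); rewrite he I0 big_set0.
have [l [b0 [eb _]]] := cech_frac b; move: hb; rewrite eb cdiff_cfrac.
move/(congr1 (fun c => prod_pr (exist _ I (introT eqP cI) : cidx n p.+1) c)).
rewrite !cfracE => /lfracP[e he].
exists (e + l)%N, (fun i => ksgn S i I *: (ymon (I :\ i) ^+ (e + k) *: b0 (I :\ i))).
rewrite -he /= -koszul_d_scale; apply: eq_bigr => i _.
rewrite !scalerA; congr (_ *: _).
rewrite (_ : (e + k + l)%N = (e + l + k)%N); last by lia.
ring.
Qed.
End TopFractions.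

Section FreeStrand.
Variables (K : fieldType) (m n : nat) (F : bigraded K m n) (j : int).
Notation S := {mpoly K[m + n]}.
Notation A := {mpoly K[m]}.
Notation y i := ('X_(rshift m i) : S).
Notation ymon := (@ymon K m n).
Notation ypow := (@ypow K m n).
Notation x_incl := (@x_incl K m n).

Lemma strand_predP (V : bigraded K m n) k (v : V) : gin (k, j) v -> strand_pred j (v : restr x_incl V).
Proof.
by move=> hv; exists [:: v]; rewrite big_seq1; split=> // x; rewrite inE => /eqP ->; exists k.
Qed.

(** Over K[x], H^n_Q(S) has as basis the y-monomials with all exponents negative. Those of the
    degree needed for each generator [b t] are written over the common denominator (y_1 ... y_n)^N,
    with numerator exponents below N. *)
Lemma fg_free_strand : fg_free F -> fg_free (strand j (lcoh n F)).
Proof.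
move=> /fg_free_coord[r [b [d [co [hd coL coE coK]]]]].
have co0 i : co i 0 = 0.
  by have := coL i 1 0 0; rewrite scaler0 addr0 mul1r -{1}[co i 0]addr0 => /addrI.
have coD i u v : co i (u + v) = co i u + co i v.
  by have := coL i 1 u v; rewrite scale1r mul1r.
have coZ i a u : co i (a *: u) = a * co i u.
  by have := coL i a u 0; rewrite !addr0 co0 addr0.
have hb : hfree xpredT b d.
  split=> // c hc i _; rewrite -(coK c i) -(co0 i); congr (co i _); exact: hc.
(* Negative exponents with sum j - (d s).2 are each at most |(d s).2 - j| in absolute value, hence
   below N. *)
pose N := (\sum_s `|(d s).2 - j|%N).+1%N.
pose T := ('I_r * {ffun 'I_n -> 'I_N})%type.
pose ex (t : T) : {ffun 'I_n -> nat} := [ffun i => t.2 i : nat].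
pose D : pred T := fun t => (d t.1).2 + (\sum_i ex t i)%N%:Z - (n * N)%N%:Z == j.
pose E (t : T) : lcoh n F := top_frac (ypow (ex t) *: b t.1) N.
have snd_n (l : nat) : ((0 : int, n%:Z) *+ l) = (0, (n * l)%N%:Z).
  elim: l => [|l IH]; first by rewrite muln0.
  by rewrite mulrS IH mulnS PoszD; congr pair; rewrite ?addr0.
have gE t : D t -> gin ((d t.1).1, j) (E t).
  move=> /eqP Dt; apply: top_frac_gin; rewrite snd_n.
  rewrite (_ : (_ + _) = (0, (\sum_i ex t i)%N%:Z) + d t.1).
    by apply: ginZ => //; apply: ypow_whomog.
  by rewrite -Dt; case: (d t.1) => d1 d2 /=; congr pair => /=; lia.
have /choice[B hB] : forall t : T, exists x : strand j (lcoh n F), D t -> smod_val x = E t.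
  move=> t; have [/gE/strand_predP/(smemP (strand_sub j _)) h|nD] := boolP (D t).
    by exists (SMod h).
  by exists 0.
apply: (@hfree_fg_free _ _ _ _ _ _ D B (fun t => (d t.1).1)).
  split=> [t Dt|c hc t0 Dt0].
    by have h := gE t Dt; rewrite -(hB t Dt) in h.
  have : top_frac (\sum_(t | D t) x_incl (c t) *: (ypow (ex t) *: b t.1)) N = 0.
    rewrite top_frac_sum -[RHS](congr1 (@smod_val _ _ _) hc).
    rewrite (big_morph (@smod_val _ _ _) (id1 := 0) (op1 := +%R)) //.
    by apply: eq_bigr => t Dt; rewrite -/(E t) -hB.
  move=> /top_frac_eq0[e [u /(congr1 (co t0.1)) hu]].
  apply/mpolyP => g; rewrite mcoeff0.
  (* The y-exponents of this monomial are below e + N, so no multiple of any y_i^(e + N) contains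
     it, and only the basis element [t0] contributes to its coefficient. *)
  pose mm := mjoin g [ffun i => ex t0 i + e]%N.
  move: hu => /(congr1 (mcoeff mm)).
  rewrite [X in _ = mcoeff mm X](big_morph (co t0.1) (id1 := 0) (op1 := +%R)) //.
  rewrite [RHS]raddf_sum [RHS]big1 /= => [|i _]; last first.
    rewrite coZ mulrC mpolyXn mcoeffMXE; case: ifP => // /mnm_lepP/(_ (rshift m i)).
    rewrite mulmnE mnm1E eqxx mul1n mjoin_r ffunE /ex ffunE.
    by rewrite addnC leq_add2r leqNgt ltn_ord.
  have cob s s' : co s (b s') = if s' == s then 1 else 0.
    rewrite -[RHS](coK (fun l => if s' == l then 1 else 0)); congr (co s _).
    rewrite (bigD1 s') //= eqxx scale1r big1 ?addr0 // => l.
    by rewrite eq_sym => /negPf ->; rewrite scale0r.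
  rewrite coZ (big_morph (co t0.1) (id1 := 0) (op1 := +%R)) // mulr_sumr raddf_sum.
  rewrite (bigD1 t0) //= big1 => [|t /andP[Dt tt0]].
    rewrite addr0 !coZ cob eqxx mulr1 ymonX mulrCA -ypowD mcoeff_x_incl_ypow.
    by case: eqP => // -[]; apply/ffunP => i; rewrite !ffunE addnC.
  rewrite !coZ cob; have [e1|_] := eqVneq t.1 t0.1; last by rewrite !mulr0 mcoeff0.
  rewrite mulr1 ymonX mulrCA -ypowD mcoeff_x_incl_ypow.
  case: eqP => // /ffunP e2; case/eqP: tt0.
  rewrite [t]surjective_pairing [t0]surjective_pairing e1; congr pair.
  apply/ffunP => i; apply/val_inj; have := e2 i; by rewrite /ex !ffunE addnC => /addIn.
move=> z.
pose sp (h : lcoh n F) := exists2 x, spanned D B x & smod_val x = h.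
have sp0 : sp 0.
  by exists 0 => //; exists (fun=> 0); rewrite big1 // => t _; rewrite scale0r.
have spD h h' : sp h -> sp h' -> sp (h + h').
  move=> [x hx ex1] [x' hx' ex2]; exists (x + x'); last by rewrite -ex1 -ex2.
  by rewrite -[x]scale1r; apply: spannedZD.
have spZ a h : sp h -> sp (x_incl a *: h).
  by move=> [x hx ex1]; exists (a *: x); [exact: spannedZ|rewrite -ex1].
have [s [hs ->]] := gin_span z; rewrite big_seq; apply: spanned_sum => {}z /hs[k gz].
suff [x hx e] : sp (smod_val z) by rewrite (_ : z = x) //; apply: val_inj.
have [v [l [gv ->]]] := gin_top_frac gz.
have top0 : top_frac (0 : F) l = 0.
  by rewrite /top_frac cfrac0 ghom0.
have topD u u' : top_frac (u + u' : F) l = top_frac u l + top_frac u' l.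
  by rewrite -[u in LHS]scale1r top_fracZD scale1r.
have topZ a u : top_frac (a *: u : F) l = a *: top_frac u l.
  by rewrite -[_ *: _ in LHS]addr0 top_fracZD top0 addr0.
have leaf t mm : mm \in msupp (co t v) -> sp (top_frac (ypow (ypart mm) *: b t) l).
  move=> hm; set delta := ypart mm.
  have sdelta : (\sum_i delta i)%N%:Z + (d t).2 = j + (n * l)%N%:Z.
    rewrite -mnm_wt_snd (hfree_coord_homog hb (c := fun t => co t v)
        (g := (k, j) + (0, n%:Z) *+ l) _ (isT : xpredT t) hm).
      by rewrite snd_n /= subrK.
    by rewrite -coE.
  clearbody delta.
  have [/existsP[i hi]|hlt] := boolP [exists i, (l <= delta i)%N].
    have -> : ypow delta = 'X_(rshift m i) ^+ l *
        ypow [ffun i' => if i' == i then delta i - l else delta i']%N.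
      rewrite /ypow (bigD1 i) //= [in RHS](bigD1 i) //= ffunE eqxx mulrA -exprD subnKC //.
      by congr (_ * _); apply: eq_bigr => i' /negPf ni; rewrite ffunE ni.
    by rewrite -scalerA top_frac_yk; apply: sp0.
  have {}hlt i : (delta i < l)%N.
    by rewrite ltnNge; apply: contra hlt => h; apply/existsP; exists i.
  have sl : (\sum_i (l - delta i) + \sum_i delta i = n * l)%N.
    rewrite -big_split /= (eq_bigr (fun=> l)) => [|i _]; last by rewrite subnK // ltnW.
    by rewrite sum_nat_const card_ord.
  have ln i : (l - delta i < N)%N.
    have h1 : (l - delta i <= \sum_i (l - delta i))%N by rewrite (bigD1 i) //= leq_addr.
    have h2 : (`|(d t).2 - j| <= \sum_s `|(d s).2 - j|)%N by rewrite (bigD1 t) //= leq_addr.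
    by rewrite /N ltnS; lia.
  (* The same integer exponents delta i - l, rewritten over the denominator N: [ln] makes the new
     numerators nonnegative, [hlt] keeps them below N. *)
  pose beta : {ffun 'I_n -> 'I_N} := [ffun i => inord (N + delta i - l)].
  have exE i : (ex (t, beta) i + l = N + delta i)%N.
    rewrite !ffunE /= inordK; first by have := ln i; lia.
    by have := hlt i; rewrite -/N; lia.
  have Dt : D (t, beta).
    have h : (\sum_i ex (t, beta) i + n * l = n * N + \sum_i delta i)%N.
      have cn q : (n * q = \sum_(i < n) q)%N by rewrite sum_nat_const card_ord.
      by rewrite !cn -!big_split; apply: eq_bigr => i _; apply: exE.
    apply/eqP; move: h sdelta; rewrite -[(t, beta).1]/t.
    move: (\sum_i ex _ i)%N (\sum_i delta i)%N (n * N)%N (n * l)%N => a1 a2 a3 a4; lia.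
  exists (B (t, beta)); first exact: spanned_mem.
  by rewrite (hB _ Dt); apply: top_frac_ypow_shift.
rewrite [v]coE; apply: (big_rec (fun u => sp (top_frac u l))) => [|t u _ hu]; first by rewrite top0.
rewrite topD; apply/spD => //.
rewrite {1}[co t v]mpolyE scaler_suml big_seq.
apply: (big_rec (fun u => sp (top_frac u l))) => [|mm u' hm hu']; first by rewrite top0.
rewrite topD; apply/spD => //; rewrite mpolyX_parts.
have -> : (co t v)@_mm *: (x_incl 'X_[xpart mm] * ypow (ypart mm)) =
   x_incl ((co t v)@_mm *: 'X_[xpart mm]) * ypow (ypart mm).
  by rewrite scalerAl /= comp_mpolyZ.
by rewrite -scalerA topZ; apply/spZ/leaf.
Qed.
End FreeStrand.

(** * The resolution of a strand *)

Section StrandExactness.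
Variables (K : fieldType) (m n : nat) (j : int).

Lemma strand_smodP (V : bigraded K m n) (v : V) :
  strand_pred j (v : restr (@x_incl K m n) V) -> exists z : strand j V, smod_val z = v.
Proof. by move=> /(smemP (strand_sub j V)) h; exists (SMod h). Qed.

Lemma sub_strand_valD (V : bigraded K m n) (P : submod (strand j V)) (z z' : smod P) :
  smod_val (smod_val (z + z')) = (smod_val (smod_val z) : V) + (smod_val (smod_val z') : V) :> V.
Proof. by []. Qed.

Lemma sub_strand_valZ (V : bigraded K m n) (P : submod (strand j V)) a (z : smod P) :
  smod_val (smod_val (a *: z)) = @x_incl K m n a *: (smod_val (smod_val z) : V) :> V.
Proof. by []. Qed.

Lemma hcomp_strand (V : bigraded K m n) k (z : strand j V) :
  smod_val (hcomp k z) = hcomp (k, j) (smod_val z : V) :> V.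
Proof.
have [h1 [s [us s0 es]]] := hcompP z.
rewrite [in RHS]es strand_val_sum hcomp_sum.
have e l : hcomp (k, j) (smod_val (hcomp l z) : V) = if l == k then smod_val (hcomp l z) : V else 0.
  have hg : gin (l, j) (smod_val (hcomp l z) : V) := gin_hcomp l z.
  by rewrite (hcomp_homog _ hg) eq_sym xpair_eqE eqxx andbT.
rewrite (eq_bigr _ (fun l _ => e l)) -big_mkcond.
have [ks|ks] := boolP (k \in s).
  by rewrite -big_filter filter_pred1_uniq // big_seq1.
by rewrite big1_seq ?s0 // => l /andP[/eqP -> /=]; rewrite (negPf ks).
Qed.

(** Only the components of [u] in degrees (k, j) are kept, for the finitely many k that occur in
    [z]; they still map onto [z]. *)
Lemma strand_lift (V W : bigraded K m n) (f : ghom V W) (z : strand j W) (u : V) :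
  f u = smod_val z -> exists u', strand_map j f u' = z.
Proof.
move=> e; have [s us es] := hcomp_span z.
suff [u' hu'] : exists u' : strand j V, smod_val u' = \sum_(k <- s) hcomp (k, j) u.
  exists u'; apply: val_inj; rewrite /= hu' ghom_sum [in RHS]es strand_val_sum.
  by apply: eq_bigr => k _; rewrite -hcomp_ghom e hcomp_strand.
apply: strand_smodP; exists [seq hcomp (k, j) u | k <- s]; rewrite big_map; split=> // x.
by move=> /mapP[k _ ->]; exists k; apply: gin_hcomp.
Qed.

Lemma strand_zero (V : bigraded K m n) : is_zero V -> is_zero (strand j V).
Proof. by move=> V0 z; apply: val_inj; apply: V0. Qed.

Lemma lcoh_zero (V : bigraded K m n) : is_zero V -> is_zero (lcoh n V).
Proof.
move=> V0 z; have [c <-] := top_class_surj z.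
have [k [v [-> _]]] := cech_frac c.
have -> : cfrac n v k = 0 by rewrite -(cfrac0 V n k); apply: eq_cfrac => I _; apply: V0.
by rewrite ghom0.
Qed.
End StrandExactness.

Lemma mnm_wt_xdeg_eq0 m (k : 'X_{1..m}) : mnm_wt (@xdeg m) k = 0 -> k = 0%MM.
Proof.
rewrite mnm_wt_x => h; apply/mnmP => i; rewrite mnm0E.
have {}h : (\sum_(i < m) k i)%N = 0%N.
  have : (\sum_(i < m) k i)%N%:Z = 0 by rewrite -h (big_morph Posz PoszD (erefl 0%Z)).
  by case.
by apply/eqP; move/eqP: h; rewrite sum_nat_eq0 => /forallP/(_ i).
Qed.

(** Induction along the complex: exactness at C_n makes C_(n+1) map onto the free module of cycles
    in C_n, and [kernel_hfree] gives a basis of the kernel. The bases are kept as families in C_n,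
    the form that [kernel_hfree] consumes. *)
Lemma fg_free_cycles (K : fieldType) (p : nat) (G : zmodType) (w : 'I_p -> G)
    (C : nat -> gmod K w) (d : forall i, ghom (C i.+1) (C i)) n :
  (forall k : 'X_{1..p}, mnm_wt w k = 0 -> k = 0%MM) ->
  (forall i, fg_free (C i)) -> (forall i x, d i (d i.+1 x) = 0) ->
  (forall i, (i < n)%N -> forall x, cyc_sub d i x -> exists y, d i y = x) ->
  fg_free (cycles d n).
Proof.
move=> wt_pos Cf dd ex.
have cyc_sub_im k x : cyc_sub d k (d k x) by case: k x => [//|k] x; apply: dd.
suff [T [D [b [e [hb sp]]]]] : exists (T : finType) (D : pred T) (b : T -> C n) e,
    hfree D b e /\ forall v, spanned D b v <-> cyc_sub d n v.
  have /choice[b' hb'] : forall t, exists z : cycles d n, D t -> smod_val z = b t.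
    move=> t; have [Dt|nD] := boolP (D t); last by exists 0.
    by have /sp/smemP h := spanned_mem b Dt; exists (SMod h).
  have val_sum c : smod_val (\sum_(t | D t) c t *: b' t) = \sum_(t | D t) c t *: b t.
    rewrite (big_morph (@smod_val _ _ _) (id1 := 0) (op1 := +%R)) //.
    by apply: eq_bigr => t Dt; rewrite -hb'.
  apply: (@hfree_fg_free _ _ _ _ _ _ D b' e).
    split=> [t Dt|c hc]; first by rewrite /= /gsub_in hb' //; apply: hb.1.
    by apply: hb.2; rewrite -val_sum hc.
  move=> v; have /smemP/sp[c hc] := smod_valP v.
  by exists c; apply: val_inj; rewrite /= val_sum.
elim: n ex => [|n IH] ex.
  have [r [b [e [hb sp]]]] := fg_free_hfree (Cf 0).
  by exists 'I_r, xpredT, b, e; split=> // v; split.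
have [|J [E [u [eu [hu spu]]]]] := IH; first by move=> i /ltnW; apply: ex.
have [r [b [e [hb sp]]]] := fg_free_hfree (Cf n.+1).
have [||D' [b' [d' [hb' sp']]]] := kernel_hfree wt_pos (f := d n) hb hu.
- by move=> t _; apply/spu/cyc_sub_im.
- move=> l El; have /spu/ex[//|v hv] := spanned_mem u El.
  by exists v => //; apply: sp.
by exists 'I_r, D', b', d'; split=> // v; rewrite sp' /=; split=> [[]|].
Qed.

Lemma fg_free_bounded_image (K : fieldType) (m n : nat) (V W : bigraded K m n) (f : ghom V W) :
  fg_free V -> (forall x, exists v, f v = x) ->
  exists t0 : int, forall g (x : W), gin g x -> (g.2 < t0)%R -> x = 0.
Proof.
move=> /fg_free_hfree[r [b [d [hb sp]]]] surj.
(* A lower bound for the y-degrees of all generators; coefficients cannot lower the y-degree. *)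
exists (- (\sum_i `|(d i).2|%N)%N%:Z) => g x gx lt.
have [v hv] := surj x.
have [|v' gv' e] := @homog_lift _ _ _ _ _ _ f g v; first by rewrite hv.
rewrite -hv -e; have [c hc] := sp v'.
rewrite hc big1 ?ghom0 // => i _; rewrite [c i](_ : _ = 0) ?scale0r //.
apply/mpolyP => mm; rewrite mcoeff0; apply/eqP; rewrite mcoeff_eq0; apply/negP => hm.
have := hfree_coord_homog hb (c := c) (g := g) _ (isT : xpredT i) hm.
rewrite -hc => /(_ gv') /(congr1 snd); rewrite mnm_wt_snd.
have -> : (g - d i).2 = g.2 - (d i).2 by [].
move=> h.
have h2 : (`|(d i).2| <= \sum_i `|(d i).2|)%N by rewrite (bigD1 i) //= leq_addr.
lia.
Qed.

Lemma acyclic_torsion (K : fieldType) (m n : nat) (V M : bigraded K m n) (f : ghom V M) :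
  fg_free V -> (forall x, exists v, f v = x) ->
  (forall i, (0 < i)%N -> is_zero (lcoh i M)) -> forall v : M, ytorsion v.
Proof.
move=> /fg_free_bounded_image h /h[t0 ht] cd0.
by apply: (bounded_acyclic_torsion ht) => p c; apply: lcoh_zero_exact; apply: cd0.
Qed.

Section Resolution.
Variables (K : fieldType) (m n : nat) (M : bigraded K m n).
Variables (F : nat -> bigraded K m n) (phi : forall i, ghom (F i.+1) (F i)).
Variable (eps : ghom (F 0) M) (j : int).
Hypothesis F_free : forall i, fg_free (F i).
Hypothesis eps_surj : forall x, exists v, eps v = x.
Hypothesis eps_exact : exact_at (phi 0) eps.
Hypothesis phi_exact : forall i, exact_at (phi i.+1) (phi i).
Hypothesis M_torsion : forall v : M, ytorsion v.

Notation C := (fun i => strand j (lcoh n (F i))).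
Notation psi := ((fun i => strand_map j (lcoh_map (phi i) n)) :
               forall i, ghom (C i.+1) (C i)).
Notation zz := (zigzag phi eps).

Lemma strand_psi_psi i (x : C i.+2) : psi i (psi i.+1 x) = 0.
Proof. by apply: val_inj; apply: (psi_psi phi_exact (smod_val x)). Qed.

Lemma cyc_sub_top_cycle i (x : C i) : cyc_sub psi i x <-> top_cycle phi (smod_val x).
Proof.
case: i x => [//|i] x; split=> [h|h]; last by apply: val_inj.
exact: (congr1 (@smod_val _ _ _) h).
Qed.

Lemma strand_top_exact i (x : C i) : i != n -> cyc_sub psi i x -> exists y, psi i y = x.
Proof.
move=> ine /cyc_sub_top_cycle.
move=> /(top_exact F_free eps_exact phi_exact M_torsion ine)[u hu].
exact: strand_lift hu.
Qed.

Lemma psi_cyclic (x : C n.+1) : psi n x \in smem (cyc_sub psi n).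
Proof.
apply/smemP/cyc_sub_top_cycle.
suff H i (y : C i.+1) : top_cycle phi (smod_val (psi i y)) by apply: H.
case: i y => [//|i] y; exact: (psi_psi phi_exact (smod_val y)).
Qed.

Definition cycle_map_fun (x : C n.+1) : cycles psi n := SMod (psi_cyclic x).

Lemma cycle_map_linear : linear cycle_map_fun.
Proof. by move=> a u v; apply: val_inj; apply: (linearP (psi n)). Qed.

Lemma cycle_map_deg g x : gin g x -> gin g (cycle_map_fun x).
Proof. exact: (ghomP (psi n)). Qed.

Definition cycle_map : ghom (C n.+1) (cycles psi n) := mk_ghom cycle_map_linear cycle_map_deg.

Lemma zigzag_homog k (z : cycles psi n) : gin k z ->
  exists2 x : strand j M, gin k x & zz (smod_val (smod_val z)) (smod_val x).
Proof.
move=> gz; have /smemP/cyc_sub_top_cycle tz := smod_valP z.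
have [x gx zx] := zigzag_total eps F_free phi_exact tz gz.
have [x' ex'] := strand_smodP (strand_predP gx).
by move: gx zx; rewrite -ex' => gx zx; exists x'.
Qed.

Lemma zigzag_strand_total (z : cycles psi n) :
  exists x : strand j M, zz (smod_val (smod_val z)) (smod_val x).
Proof.
pose Q (z : cycles psi n) := exists x : strand j M, zz (smod_val (smod_val z)) (smod_val x).
have [s [hs ->]] := gin_span z; rewrite big_seq; apply: (big_rec Q) => [|y z' /hs[k gy] [x' hx']].
  by exists 0; apply: zigzag0.
have [x _ hx] := zigzag_homog gy; exists (x + x').
rewrite /Q (sub_strand_valD y z').
exact: zigzagD hx hx'.
Qed.

(** The zigzag relation read as a function; linearity and degree follow from uniqueness of the
    partner, not from the choice. *)
Definition augmentation_fun (z : cycles psi n) : strand j M := projT1 (cid (zigzag_strand_total z)).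

Lemma augmentationP (z : cycles psi n) : zz (smod_val (smod_val z)) (smod_val (augmentation_fun z)).
Proof. exact: projT2 (cid (zigzag_strand_total z)). Qed.

Lemma zigzag_strand_uniq h (x x' : strand j M) :
  zz h (smod_val x) -> zz h (smod_val x') -> x = x'.
Proof. by move=> zx zx'; apply: val_inj; apply: (zigzag_uniq F_free eps_exact phi_exact zx zx'). Qed.

Lemma augmentation_linear : linear augmentation_fun.
Proof.
move=> a u v; apply: zigzag_strand_uniq; first exact: augmentationP.
rewrite (sub_strand_valD (a *: u) v) (sub_strand_valZ a u).
exact: zigzagP (augmentationP u) (augmentationP v).
Qed.

Lemma augmentation_deg k z : gin k z -> gin k (augmentation_fun z).
Proof.
move=> /zigzag_homog[x gx zx].
by rewrite (zigzag_strand_uniq (augmentationP z) zx).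
Qed.

Definition augmentation : ghom (cycles psi n) (strand j M) :=
  mk_ghom augmentation_linear augmentation_deg.

Lemma augmentation_homog_surj k x : gin k x -> exists z, augmentation z = x.
Proof.
move=> gx; have gx' : gin (k, j) (smod_val x : M) := gx.
have [h th zh] := zigzag_surj eps_surj eps_exact phi_exact M_torsion (smod_val x).
(* The partner [h] of x may leave the strand; its component of degree (k, j) is still a partner,
   since x is homogeneous. *)
have := zigzag_hcomp F_free eps_exact phi_exact (k, j) th zh; rewrite (hcomp_id gx') => zh'.
have [y ey] := strand_smodP (strand_predP (gin_hcomp (k, j) h)).
have hy : y \in smem (cyc_sub psi n).
  by apply/smemP/cyc_sub_top_cycle; rewrite ey; apply: top_cycle_hcomp.
exists (SMod hy : cycles psi n); apply: zigzag_strand_uniq zh'.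
rewrite -ey; exact: (augmentationP (SMod hy)).
Qed.

Lemma augmentation_surj x : exists z, augmentation z = x.
Proof.
pose Q x := exists z, augmentation z = x.
have [s [hs ->]] := gin_span x; rewrite big_seq; apply: (big_rec Q) => [|y x' ys [z' hz']].
  by exists 0; apply: ghom0.
have [k gy] := hs y ys; have [z hz] := augmentation_homog_surj gy.
by exists (z + z'); rewrite ghomD hz hz'.
Qed.

Lemma augmentation_exact : exact_at cycle_map augmentation.
Proof.
move=> z; split=> [e|[u <-]].
  have := augmentationP z; rewrite -[augmentation_fun z]/(augmentation z) e.
  move=> /(zigzag_ker eps_exact phi_exact)[u hu].
  have [u' hu'] := strand_lift hu.
  by exists u'; apply: val_inj.
have h : zz (lcoh_map (phi n) n (smod_val u)) (smod_val (augmentation_fun (cycle_map u))).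
  exact: (augmentationP (cycle_map u)).
by apply: val_inj; apply: (zigzag_im F_free eps_exact phi_exact h).
Qed.
End Resolution.

Theorem corollary2p3 (K : fieldType) (m n : nat) (M : bigraded K m n)
    (F : nat -> bigraded K m n) (phi : forall i, ghom (F i.+1) (F i))
    (eps : ghom (F 0) M) :
  fin_gen M ->
  is_cd M 0 ->
  free_resolution (m + n) phi eps ->
  forall j : int,
  let C := fun i => strand j (lcoh n (F i)) in
  let psi := (fun i => strand_map j (lcoh_map (phi i) n)) :
               forall i, ghom (C i.+1) (C i) in
  fin_gen (strand j M) /\
  exists (d : ghom (C n.+1) (cycles psi n)) (e : ghom (cycles psi n) (strand j M)),
    (forall v, smod_val (d v) = psi n v) /\
    free_resolution m (tail_diff psi d) e.
Proof.
move=> _ [_ cd0] [Ff eps_surj eps_ex phi_ex F0] j C psi.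
have tor := acyclic_torsion (Ff 0) eps_surj cd0.
have Cf i : fg_free (C i) by apply/fg_free_strand/Ff.
pose d := cycle_map j phi_ex; pose e := augmentation j Ff eps_ex phi_ex.
have e_surj : forall x, exists z, e z = x by apply: augmentation_surj.
have Zf : fg_free (cycles psi n).
  apply: fg_free_cycles => //; first exact: mnm_wt_xdeg_eq0.
    exact: strand_psi_psi.
  move=> i i_n x; apply: strand_top_exact => //; by rewrite ltn_eqF.
have dE v : smod_val (d v) = psi n v by [].
split.
  (* M_j is generated by the images of a basis of Ker psi_n. *)
  have [r [b [_ [_ hb]]]] := Zf; exists r, (fun i => e (b i)) => x.
  have [z <-] := e_surj x; have [c [hc _]] := hb z; exists c.
  by rewrite hc ghom_sum; apply: eq_bigr => i _; apply: ghomZ.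
exists d, e; split=> //; split=> //.
- by case=> [|i]; [exact: Zf | exact: Cf].
- exact: augmentation_exact.
- have ex i (v : C i.+1) : i.+1 != n -> psi i v = 0 <-> exists u, psi i.+1 u = v.
    move=> ne; split=> [h|[u <-]]; last exact: strand_psi_psi.
    exact: (strand_top_exact Ff eps_ex phi_ex tor ne h).
  case=> [|k] v; last by apply: (ex (k.+1 + n)%N v); lia.
  (* At C_(n+1) the target is Ker psi_n; its inclusion into C_n is injective, so exactness there is
     exactness for psi n. *)
  have [h1 h2] := ex n v ltac:(lia).
  split=> [h|/h2 h]; last exact: val_inj.
  by apply: h1; rewrite -dE -[RHS](congr1 (@smod_val _ _ _) h).
(* Place k+1 of the tail is built from F_(n+k+1), whose index exceeds m + n when k + 1 > m. *)
- case=> // k mk; apply/strand_zero/lcoh_zero/F0; lia.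
Qed.
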